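(* Let $T$ be a bounded spherical $m$-variable weighted shift and let $T_\delta$ be the one-variable weighted shift associated with $T$. Then: (1) $T$ is jointly subnormal iff $T_\delta$ is subnormal; (2) $T$ is a joint $q$-isometry iff $T_\delta$ is a $q$-isometry; (3) $T$ is a joint $q$-expansion iff $T_\delta$ is a $q$-expansion; (4) $T$ is a joint complete hyperexpansion iff $T_\delta$ is a complete hyperexpansion; (5) $T$ is jointly hyponormal iff $T_\delta$ is hyponormal.
   Context: An $m$-variable weighted shift with positive weights $\{w^{(j)}_n\}$ on an orthonormal basis $\{e_n\}_{n\in\mathbb N^m}$ is the commuting tuple $T_je_n=w^{(j)}_ne_{n+\epsilon_j}$. $T$ is spherical if for every $U=(u_{jk})\in\mathcal U(m)$ there is a unitary $\Gamma(U)$ with $\Gamma(U)T_j=\big(\sum_ku_{jk}T_k\big)\Gamma(U)$ for all $j$. For such $T$ there is a unique positive sequence $\{b_k\}$ with $\|T^ne_0\|=b_{|n|}\sqrt{\frac{(m-1)!\,n!}{(m-1+|n|)!}}$; $T_\delta$ is the unilateral weighted shift $T_\delta f_k=\delta_kf_{k+1}$ with $\delta_k=b_{k+1}/b_k$. For a commuting tuple $T$: $Q_T(X)=\sum_iT_i^*XT_i$, $Q^0_T(I)=I$, $Q_T^k(I)=Q_T(Q_T^{k-1}(I))$, and $B_q(Q_T)=\sum_{s=0}^q(-1)^s\binom qsQ_T^s(I)$. $T$ is a joint $q$-expansion if $B_q(Q_T)\le0$, a joint $q$-isometry if $B_q(Q_T)=0$, and a joint complete hyperexpansion if it is a joint $k$-expansion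 for every $k\ge1$; for $m=1$ the word ''joint'' is dropped. $T$ is jointly subnormal if there are commuting normal operators $N_i$ on a larger Hilbert space with $N_i|_{\mathcal H}=T_i$; $T$ is jointly hyponormal if the operator matrix $([T_j^*,T_i])_{1\le i,j\le m}$ on $\mathcal H^{(m)}$ is positive. *)

(* Defs.v *)
(* reals (realType) + complex numbers R[i] from mathcomp-real-closed. *)
From HB Require Import structures.
From mathcomp Require Import all_boot all_order all_algebra.
From mathcomp Require Import reals.
From mathcomp.real_closed Require Import complex.
From Stdlib Require Import ClassicalEpsilon.

Set Implicit Arguments.
Unset Strict Implicit.
Unset Printing Implicit Defensive.

Import Order.TTheory GRing.Theory Num.Theory.
Local Open Scope ring_scope.

(* Complex Hilbert spaces (defined honestly: inner-product space over  *)
(* C = R[i] that is complete for the induced norm).                   *)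

Record hilbert (R : realType) := Hilbert {
  hcar :> lmodType R[i];
  hinner : hcar -> hcar -> R[i];
  hinnerDl : forall (a : R[i]) (x y z : hcar),
      hinner (a *: x + y) z = a * hinner x z + hinner y z;
  hinner_conj : forall x y : hcar, hinner y x = (hinner x y)^*;
  hinner_ge0 : forall x : hcar, 0 <= hinner x x;
  hinner_eq0 : forall x : hcar, hinner x x = 0 -> x = 0;
  hcomplete : forall u : nat -> hcar,
      (forall eps : R, 0 < eps -> exists N, forall p q, (N <= p)%N -> (N <= q)%N ->
          Num.sqrt (complex.Re (hinner (u p - u q) (u p - u q))) < eps) ->
      exists l : hcar, forall eps : R, 0 < eps -> exists N, forall p, (N <= p)%N ->
          Num.sqrt (complex.Re (hinner (u p - l) (u p - l))) < eps
}.

Section Ops.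
Variable R : realType.

(* norm ||x|| = sqrt <x,x> *)
Definition hnorm (H : hilbert R) (x : H) : R :=
  Num.sqrt (complex.Re (hinner x x)).

Definition is_linear (H K : hilbert R) (A : H -> K) : Prop :=
  forall (a : R[i]) (x y : H), A (a *: x + y) = a *: A x + A y.

(* bounded (= continuous) linear operator *)
Definition bounded_op (H K : hilbert R) (A : H -> K) : Prop :=
  is_linear A /\ exists M : R, forall x, hnorm (A x) <= M * hnorm x.

(* B is the Hilbert-space adjoint of A *)
Definition is_adjoint (H : hilbert R) (A B : H -> H) : Prop :=
  forall x y : H, hinner (A x) y = hinner x (B y).

(* the adjoint A^* of an operator (chosen; it is unique when it exists,
   and it exists for bounded operators by the Riesz representation theorem) *)
Definition adj (H : hilbert R) (A : H -> H) : H -> H :=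
  match excluded_middle_informative (exists B, is_adjoint A B) with
  | left P => proj1_sig (constructive_indefinite_description _ P)
  | right _ => A
  end.

Definition normal_op (H : hilbert R) (N : H -> H) : Prop :=
  bounded_op N /\ exists Ns, is_adjoint N Ns /\ (forall x, N (Ns x) = Ns (N x)).

Definition unitary_op (H : hilbert R) (G : H -> H) : Prop :=
  is_linear G /\ (forall x y, hinner (G x) (G y) = hinner x y) /\
  (forall y, exists x, G x = y).

(* operator inequalities:  X <= 0  and  0 <= X *)
Definition op_le0 (H : hilbert R) (X : H -> H) : Prop :=
  forall x : H, hinner (X x) x <= 0.

(* orthonormal basis indexed by I: orthonormal and maximal (total) *)
Definition orthonormal_basis (I : Type) (H : hilbert R) (e : I -> H) : Prop :=
  (forall i, hinner (e i) (e i) = 1) /\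
  (forall i j, i <> j -> hinner (e i) (e j) = 0) /\
  (forall x : H, (forall i, hinner x (e i) = 0) -> x = 0).

(* Notions for a commuting m-tuple T : 'I_m -> (H -> H)               *)

Definition commuting_tuple (m : nat) (H : hilbert R) (T : 'I_m -> H -> H) : Prop :=
  forall i j x, T i (T j x) = T j (T i x).

(* Q_T(X) = \sum_i T_i^* X T_i *)
Definition QT (m : nat) (H : hilbert R) (T : 'I_m -> H -> H) (X : H -> H) : H -> H :=
  fun x => \sum_(i < m) adj (T i) (X (T i x)).

(* Q_T^k(I) *)
Definition QTpow (m : nat) (H : hilbert R) (T : 'I_m -> H -> H) (k : nat) : H -> H :=
  iter k (QT T) id.

(* B_q(Q_T) = \sum_{s=0}^q (-1)^s binom(q,s) Q_T^s(I) *)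
Definition Bq (m : nat) (H : hilbert R) (T : 'I_m -> H -> H) (q : nat) : H -> H :=
  fun x => \sum_(s < q.+1) (((-1) ^+ s * ('C(q, s))%:R) : R[i]) *: QTpow T s x.

Definition joint_q_expansion (m : nat) (H : hilbert R) (T : 'I_m -> H -> H) (q : nat) :=
  op_le0 (Bq T q).

Definition joint_q_isometry (m : nat) (H : hilbert R) (T : 'I_m -> H -> H) (q : nat) :=
  forall x, Bq T q x = 0.

Definition joint_complete_hyperexpansion (m : nat) (H : hilbert R) (T : 'I_m -> H -> H) :=
  forall k : nat, (1 <= k)%N -> joint_q_expansion T k.

(* joint subnormality: commuting normal extension on a larger Hilbert space;
   "H is contained in K" is modelled by an isometric linear embedding V *)
Definition jointly_subnormal (m : nat) (H : hilbert R) (T : 'I_m -> H -> H) : Prop :=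
  exists (K : hilbert R) (V : H -> K) (N : 'I_m -> K -> K),
    is_linear V /\ (forall x y, hinner (V x) (V y) = hinner x y) /\
    (forall i, normal_op (N i)) /\
    (forall i j z, N i (N j z) = N j (N i z)) /\
    (forall i x, N i (V x) = V (T i x)).

(* joint hyponormality: ([T_j^*, T_i])_{i,j} >= 0 on H^(m) *)
Definition jointly_hyponormal (m : nat) (H : hilbert R) (T : 'I_m -> H -> H) : Prop :=
  forall x : 'I_m -> H,
    0 <= \sum_(i < m) \sum_(j < m)
           hinner (adj (T j) (T i (x j)) - T i (adj (T j) (x j))) (x i).

(* one-variable versions (m = 1, "joint" dropped) *)
Definition tuple1 (H : hilbert R) (S : H -> H) : 'I_1 -> H -> H := fun _ => S.

Definition subnormal (H : hilbert R) (S : H -> H) := jointly_subnormal (tuple1 S).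
Definition q_isometry (H : hilbert R) (S : H -> H) q := joint_q_isometry (tuple1 S) q.
Definition q_expansion (H : hilbert R) (S : H -> H) q := joint_q_expansion (tuple1 S) q.
Definition complete_hyperexpansion (H : hilbert R) (S : H -> H) :=
  joint_complete_hyperexpansion (tuple1 S).
Definition hyponormal (H : hilbert R) (S : H -> H) := jointly_hyponormal (tuple1 S).

(* Multi-indices, weighted shifts, sphericality                        *)

Definition mindex (m : nat) := {ffun 'I_m -> nat}.

(* n + eps_j *)
Definition mshift (m : nat) (n : mindex m) (j : 'I_m) : mindex m :=
  [ffun i => (n i + (i == j))%N].

Definition mzero (m : nat) : mindex m := [ffun => 0%N].

(* |n| and n! *)
Definition mabs (m : nat) (n : mindex m) : nat := (\sum_(i < m) n i)%N.
Definition mfact (m : nat) (n : mindex m) : nat := (\prod_(i < m) (n i)`!)%N.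

(* T^n x = T_1^{n_1} ... T_m^{n_m} x *)
Definition tpow (m : nat) (H : hilbert R) (T : 'I_m -> H -> H) (n : mindex m) (x : H) : H :=
  foldr (fun j y => iter (n j) (T j) y) x (enum 'I_m).

(* T is the m-variable weighted shift with positive weights w on the ONB e *)
Definition is_weighted_shift (m : nat) (H : hilbert R) (e : mindex m -> H)
    (w : 'I_m -> mindex m -> R) (T : 'I_m -> H -> H) : Prop :=
  orthonormal_basis e /\
  (forall j n, 0 < w j n) /\
  commuting_tuple T /\
  (forall j n, T j (e n) = ((w j n)%:C)%C *: e (mshift n j)).

Definition bounded_tuple (m : nat) (H : hilbert R) (T : 'I_m -> H -> H) : Prop :=
  forall j, bounded_op (T j).

Definition unitary_mx (m : nat) (U : 'M[R[i]]_m) : Prop :=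
  U *m (map_mx (fun z => z^*) U)^T = 1%:M.

Definition spherical (m : nat) (H : hilbert R) (T : 'I_m -> H -> H) : Prop :=
  forall U : 'M[R[i]]_m, unitary_mx U ->
    exists G : H -> H, unitary_op G /\
      forall j x, G (T j x) = \sum_(k < m) U j k *: T k (G x).

(* b is the (unique positive) sequence with
   ||T^n e_0|| = b_{|n|} sqrt((m-1)! n! / (m-1+|n|)!) *)
Definition spherical_seq (m : nat) (H : hilbert R) (e : mindex m -> H)
    (T : 'I_m -> H -> H) (b : nat -> R) : Prop :=
  (forall k, 0 < b k) /\
  forall n : mindex m,
    hnorm (tpow T n (e (mzero m))) =
      b (mabs n) * Num.sqrt (((m.-1)`! * mfact n)%:R / ((m.-1 + mabs n)`!)%:R).

(* S is the unilateral weighted shift S f_k = delta_k f_{k+1} on the ONB f *)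
Definition is_uni_weighted_shift (H : hilbert R) (f : nat -> H) (delta : nat -> R)
    (S : H -> H) : Prop :=
  orthonormal_basis f /\ forall k, S (f k) = ((delta k)%:C)%C *: f k.+1.

End Ops.

(* Main.v *)
Require Import Defs.
From HB Require Import structures.
From mathcomp Require Import all_boot all_order all_algebra.
From mathcomp Require Import reals.
From mathcomp.real_closed Require Import complex polyrcf.
From mathcomp Require Import cyclic separable cyclotomic.
From mathcomp Require Import zify ring lra.
From Stdlib Require Import ClassicalEpsilon.
Import Order.TTheory GRing.Theory Num.Theory.

(** Up to normalization T acts on an orthogonal total family g_n by T_j g_n = g_{n + e_j}, with
    |g_n|^2 = b_|n|^2 n! / (m - 1 + |n|)!; for m = 1 this is T_delta, with |g_n|^2 = b_n^2. Each
    property turns out to be equivalent to a condition on the sequence b alone, independent of m.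
    - Q_T^s(I) g_n = (b_{|n|+s}^2 / b_|n|^2) g_n, so q-isometries and q-expansions are read off from
      the signs of the alternating sums of b^2.
    - T is hyponormal iff b^2 is logarithmically convex, and subnormal iff all the kernels
      (s, t) |-> b_{l+s+t}^2 are positive semidefinite. Necessity comes from the vectors
      (sum_i N_i^* N_i)^s g_n, by Fuglede's theorem. For sufficiency, the Dirichlet integral
      n! / (m - 1 + |n|)! is an iterated beta integral, so multiplying by it preserves positivity;
      the resulting kernel on pairs of multi-indices is the Gram matrix of vectors on which the
      normal extension acts by shifts. Hyponormality is the same statement in first order. *)

(** Subnormality provides normal N_i that commute with each other, but says nothing about N_j and
    N_i^*. The operator P = sum_i N_i^* N_i is useful only once it commutes with every N_j: then the
    compression of P^s to the original space is Q_T^s(I), which is diagonal on the g_n. Fuglede's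
    theorem gives this commutation. Its classical proof applies Liouville's theorem to operator
    exponentials; powers (1 + z N / n)^n and averages over roots of unity take their place here, at
    the price of a defect to be estimated. In the converse direction no representing measure is
    built, and two obstacles shape the argument. A larger Hilbert space would call for a completion;
    instead, H being infinite-dimensional, the countable kernel is realized inside H itself, and the
    original space is embedded there by a new isometry. The shifts on the realizing vectors must
    moreover be well defined and bounded; both follow from a norm estimate that logarithmic
    convexity reduces to an exponential growth rate, visible on single entries of the kernel. *)

Set Implicit Arguments.
Unset Strict Implicit.
Unset Printing Implicit Defensive.

Local Open Scope ring_scope.

Local Notation "''[' x , y ]" := (hinner x y) (format "''[' x ,  y ]").
Local Notation "x %:C" := (real_complex _ x) (format "x %:C") : ring_scope.

(** * Complex modulus and inner products *)

Section Modulus.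
Variable R : realType.
Implicit Types z w : R[i].

(** The norm of [R[i]] takes values in [R[i]], whereas [hnorm] and all estimates live in [R]. *)
Definition cmod z : R := complex.Re `|z|.

Lemma cmodE z : `|z| = (cmod z)%:C.
Proof. by rewrite /cmod RRe_real // normr_real. Qed.

Lemma cmod_ge0 z : 0 <= cmod z.
Proof. by rewrite -ler0c -cmodE. Qed.

Lemma cmodM z w : cmod (z * w) = cmod z * cmod w.
Proof. by apply: complexI; rewrite rmorphM /= -!cmodE normrM. Qed.

Lemma cmodD z w : cmod (z + w) <= cmod z + cmod w.
Proof. by rewrite -lecR rmorphD /= -!cmodE ler_normD. Qed.

Lemma cmodN z : cmod (- z) = cmod z.
Proof. by rewrite /cmod normrN. Qed.

Lemma cmodJ z : cmod (z^*) = cmod z.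
Proof. by rewrite /cmod norm_conjC. Qed.

Lemma cmod0 : cmod 0 = 0 :> R.
Proof. by rewrite /cmod normr0. Qed.

Lemma cmod1 : cmod 1 = 1 :> R.
Proof. by rewrite /cmod normr1. Qed.

Lemma cmodX z n : cmod (z ^+ n) = cmod z ^+ n.
Proof. by elim: n => [|n IH]; rewrite ?cmod1 // !exprS cmodM IH. Qed.

Lemma cmod_real (a : R) : cmod (a%:C) = `|a|.
Proof. by rewrite /cmod normc_def /= expr0n /= addr0 sqrtr_sqr. Qed.

Lemma cmod_eq0 z : (cmod z == 0) = (z == 0).
Proof. by rewrite -(normr_eq0 z) cmodE eq_complex /= eqxx andbT. Qed.

Lemma cmod_sum (I : Type) (r : seq I) (P : pred I) (F : I -> R[i]) :
  cmod (\sum_(i <- r | P i) F i) <= \sum_(i <- r | P i) cmod (F i).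
Proof.
elim/big_rec2: _ => [|i y1 y2 _ le]; first by rewrite cmod0.
by apply: le_trans (cmodD _ _) _; rewrite lerD2l.
Qed.

Lemma Re_le_cmod z : complex.Re z <= cmod z.
Proof.
rewrite /cmod normc_def /=; apply: le_trans (ler_norm _) _.
by rewrite -sqrtr_sqr ler_wsqrtr // lerDl sqr_ge0.
Qed.

Lemma mul_conj z : z * z^* = ((cmod z ^+ 2)%:C).
Proof. by rewrite -normCK cmodE rmorphXn. Qed.

Lemma conjM z w : (z * w)^* = z^* * w^*.
Proof. exact: rmorphM. Qed.

Lemma conjN z : (- z)^* = - z^*.
Proof. exact: rmorphN. Qed.

Lemma conjK z : (z^*)^* = z.
Proof. exact: conjCK. Qed.

Lemma scaleCE z w : z *: (w : R[i]^o) = z * w.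
Proof. by []. Qed.

Lemma conj_RC (a : R) : ((a%:C))^* = (a%:C).
Proof. by apply/CrealP; apply/complex_realP; exists a. Qed.

Lemma Re_conj z : complex.Re z^* = complex.Re z.
Proof. by case: z. Qed.

Lemma ReD z w : complex.Re (z + w) = complex.Re z + complex.Re w.
Proof. by case: z w => [? ?] []. Qed.

Lemma ReN z : complex.Re (- z) = - complex.Re z.
Proof. by case: z. Qed.

Lemma ReRC (a : R) z : complex.Re ((a%:C) * z) = a * complex.Re z.
Proof. by case: z => x y /=; rewrite mul0r subr0. Qed.

Lemma ge0_RC z : 0 <= z -> z = ((complex.Re z)%:C).
Proof. by move=> /ger0_real /RRe_real. Qed.

Lemma ge0_Re z : 0 <= z -> 0 <= complex.Re z.
Proof. by rewrite lecE => /andP[]. Qed.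

End Modulus.

Section InnerProduct.
Variables (R : realType) (H : hilbert R).
Implicit Types (x y z : H) (a : R[i]).

Lemma innerC x y : '[y, x] = ('[x, y])^*.
Proof. exact: hinner_conj. Qed.

Lemma innerDl x y z : '[x + y, z] = '[x, z] + '[y, z].
Proof. by rewrite -[x]scale1r hinnerDl scale1r mul1r. Qed.

Lemma inner0l z : '[0, z] = 0.
Proof. by apply: (addrI '[0, z]); rewrite -innerDl !addr0. Qed.

Lemma innerZl a x z : '[a *: x, z] = a * '[x, z].
Proof. by rewrite -[a *: x]addr0 hinnerDl inner0l addr0. Qed.

Lemma innerNl x z : '[- x, z] = - '[x, z].
Proof. by rewrite -scaleN1r innerZl mulN1r. Qed.

Lemma innerBl x y z : '[x - y, z] = '[x, z] - '[y, z].
Proof. by rewrite innerDl innerNl. Qed.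

Lemma inner_suml (I : Type) (r : seq I) (P : pred I) (F : I -> H) z :
  '[\sum_(i <- r | P i) F i, z] = \sum_(i <- r | P i) '[F i, z].
Proof.
by elim/big_rec2: _ => [|i u v _ <-]; rewrite ?inner0l ?innerDl.
Qed.

Lemma innerDr x y z : '[z, x + y] = '[z, x] + '[z, y].
Proof. by rewrite innerC innerDl rmorphD /= -!innerC. Qed.

Lemma inner0r z : '[z, 0] = 0.
Proof. by rewrite innerC inner0l rmorph0. Qed.

Lemma innerZr a x z : '[z, a *: x] = a^* * '[z, x].
Proof. by rewrite innerC innerZl rmorphM /= -innerC. Qed.

Lemma innerNr x z : '[z, - x] = - '[z, x].
Proof. by rewrite innerC innerNl rmorphN /= -innerC. Qed.

Lemma innerBr x y z : '[z, x - y] = '[z, x] - '[z, y].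
Proof. by rewrite innerDr innerNr. Qed.

Lemma inner_sumr (I : Type) (r : seq I) (P : pred I) (F : I -> H) z :
  '[z, \sum_(i <- r | P i) F i] = \sum_(i <- r | P i) '[z, F i].
Proof.
by elim/big_rec2: _ => [|i u v _ <-]; rewrite ?inner0r ?innerDr.
Qed.

Lemma inner_ext x y : (forall z, '[x, z] = '[y, z]) -> x = y.
Proof.
move=> E; apply/eqP; rewrite -subr_eq0; apply/eqP/hinner_eq0.
by rewrite innerBl E subrr.
Qed.

Lemma hnorm_ge0 x : 0 <= hnorm x.
Proof. exact: sqrtr_ge0. Qed.

Lemma hnorm_sqr x : hnorm x ^+ 2 = complex.Re '[x, x].
Proof. by rewrite sqr_sqrtr // ge0_Re // hinner_ge0. Qed.

Lemma inner_hnorm x : '[x, x] = ((hnorm x ^+ 2)%:C).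
Proof. by rewrite hnorm_sqr; apply/ge0_RC/hinner_ge0. Qed.

Lemma hnorm_eq0 x : hnorm x = 0 -> x = 0.
Proof. by move=> E; apply: hinner_eq0; rewrite inner_hnorm E expr0n. Qed.

Lemma hnorm0 : hnorm (0 : H) = 0.
Proof. by rewrite /hnorm inner0l sqrtr0. Qed.

Lemma cauchy_schwarz x y : cmod '[x, y] <= hnorm x * hnorm y.
Proof.
have [y0|yn0] := eqVneq (hnorm y) 0.
  by rewrite (hnorm_eq0 y0) inner0r cmod0 hnorm0 mulr0.
have yy : 0 < hnorm y ^+ 2 by rewrite exprn_even_gt0.
rewrite -(ler_pXn2r (ltn0Sn 1)) ?nnegrE ?cmod_ge0 ?mulr_ge0 ?hnorm_ge0 //.
(* This is |y|^2 times the component of x orthogonal to y, cleared of the division. *)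
have := hinner_ge0 (((hnorm y ^+ 2)%:C) *: x - '[x, y] *: y).
rewrite innerBl !innerBr !innerZl !innerZr conj_RC (innerC x y) !inner_hnorm.
set p := '[x, y]; move: yy; set X := hnorm x ^+ 2; set Y := hnorm y ^+ 2 => yy.
have -> : (Y%:C * (Y%:C * X%:C) - Y%:C * (p^* * p) -
    (p * (Y%:C * p^*) - p * (p^* * Y%:C))) = ((Y * (Y * X - cmod p ^+ 2))%:C).
  transitivity (Y%:C * (Y%:C * X%:C - p * p^*)); first by ring.
  by rewrite mul_conj; move: X Y {yy} => X Y; rewrite (rmorphM _ Y) rmorphB (rmorphM _ Y).
by rewrite ler0c pmulr_rge0 // subr_ge0 exprMn mulrC.
Qed.

Lemma hnormZ a x : hnorm (a *: x) = cmod a * hnorm x.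
Proof.
apply/eqP; rewrite -(eqrXn2 (ltn0Sn 1)) ?mulr_ge0 ?hnorm_ge0 ?cmod_ge0 //.
rewrite exprMn !hnorm_sqr innerZl innerZr mulrA mul_conj ReRC.
by rewrite -hnorm_sqr.
Qed.

Lemma hnormN x : hnorm (- x) = hnorm x.
Proof. by rewrite -scaleN1r hnormZ cmodN cmod1 mul1r. Qed.

Lemma hnormBC x y : hnorm (x - y) = hnorm (y - x).
Proof. by rewrite -hnormN opprB. Qed.

Lemma hnormD_sqr x y :
  hnorm (x + y) ^+ 2 = hnorm x ^+ 2 + hnorm y ^+ 2 + 2 * complex.Re '[x, y].
Proof.
rewrite !hnorm_sqr innerDl !innerDr !ReD (innerC x y) Re_conj; ring.
Qed.

Lemma hnormD x y : hnorm (x + y) <= hnorm x + hnorm y.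
Proof.
rewrite -(ler_pXn2r (ltn0Sn 1)) ?nnegrE ?addr_ge0 ?hnorm_ge0 //.
rewrite hnormD_sqr.
have := le_trans (Re_le_cmod _) (cauchy_schwarz x y).
by move: (hnorm x) (hnorm y) => u v; nra.
Qed.

(** * Limits of vectors and of scalars *)

Definition hcvg (u : nat -> H) (l : H) : Prop :=
  forall eps : R, 0 < eps -> exists N, forall p, (N <= p)%N -> hnorm (u p - l) < eps.

Definition ccvg (z : nat -> R[i]) (l : R[i]) : Prop :=
  forall eps : R, 0 < eps -> exists N, forall p, (N <= p)%N -> cmod (z p - l) < eps.

Lemma ccvgD u v a b : ccvg u a -> ccvg v b -> ccvg (fun n => u n + v n) (a + b).
Proof.
move=> cu cv eps e0; have e2 : 0 < eps / 2 by lra.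
have [N hN] := cu _ e2; have [M hM] := cv _ e2.
exists (maxn N M) => p; rewrite geq_max => /andP[/hN h1 /hM h2].
rewrite opprD addrACA; apply: le_lt_trans (cmodD _ _) _; lra.
Qed.

Lemma ccvg_sum (I : Type) (r : seq I) (F : I -> nat -> R[i]) (l : I -> R[i]) :
  (forall i, ccvg (F i) (l i)) ->
  ccvg (fun n => \sum_(i <- r) F i n) (\sum_(i <- r) l i).
Proof.
move=> cF; elim: r => [|i r IH].
  by move=> eps e0; exists 0%N => p _; rewrite !big_nil subrr cmod0.
move=> eps e0; have [N hN] := ccvgD (cF i) IH e0.
by exists N => p /hN; rewrite !big_cons.
Qed.

Lemma ccvg_uniq u a b : ccvg u a -> ccvg u b -> a = b.
Proof.
move=> ca cb; apply/eqP; rewrite -subr_eq0 -cmod_eq0 eq_le cmod_ge0 andbT.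
rewrite leNgt; apply/negP => d0.
have d2 : 0 < cmod (a - b) / 2 by lra.
have [N hN] := ca _ d2; have [M hM] := cb _ d2.
have h1 := hN _ (leq_maxl N M); have h2 := hM _ (leq_maxr N M).
have := cmodD (a - u (maxn N M)) (u (maxn N M) - b).
rewrite subrKA -[cmod (a - u _)]cmodN opprB; lra.
Qed.

Lemma ccvg_ge0 u a : ccvg u a -> (forall n, 0 <= u n) -> 0 <= a.
Proof.
move=> ca u0.
(* The sequence also converges to |Re a|, which is nonnegative by construction; uniqueness of limits
   concludes. *)
have cb : ccvg u ((`|complex.Re a|%:C)).
  move=> eps e0; have [N hN] := ca _ e0; exists N => p /hN; apply: le_lt_trans.
  rewrite (ge0_RC (u0 p)) -rmorphB /= cmod_real.
  have := ge0_Re (u0 p); case: a {ca hN} => x y /= up.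
  rewrite /cmod normc_def /=.
  apply: (@le_trans _ _ `|complex.Re (u p) - x|).
    have := ler_dist_dist (complex.Re (u p)) x.
    by rewrite (ger0_norm up).
  by rewrite -sqrtr_sqr ler_wsqrtr // lerDl sqr_ge0.
by rewrite (ccvg_uniq ca cb) ler0c.
Qed.

Lemma hcvg_bounded u x : hcvg u x -> exists M, exists N, forall p, (N <= p)%N -> hnorm (u p) <= M.
Proof.
move=> cu; have [N hN] := cu 1 ltr01.
exists (1 + hnorm x), N => p /hN h.
rewrite -[u p](subrK x); apply: le_trans (hnormD _ _) _; lra.
Qed.

Lemma ccvg_inner u x v y : hcvg u x -> hcvg v y ->
  ccvg (fun n => '[u n, v n]) '[x, y].
Proof.
move=> cu cv eps e0.
have [M [N0 hM]] := hcvg_bounded cv.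
have k0 : 0 < `|M| + hnorm x + 1 by have := hnorm_ge0 x; have := normr_ge0 M; lra.
have [N1 h1] := cu _ (divr_gt0 e0 k0); have [N2 h2] := cv _ (divr_gt0 e0 k0).
exists (maxn N0 (maxn N1 N2)) => p; rewrite !geq_max => /andP[/hM a /andP[/h1 b /h2 c]].
have -> : '[u p, v p] - '[x, y] = '[u p - x, v p] + '[x, v p - y].
  by rewrite innerBl innerBr; ring.
apply: le_lt_trans (cmodD _ _) _.
have A := cauchy_schwarz (u p - x) (v p); have B := cauchy_schwarz x (v p - y).
move: b c; rewrite !ltr_pdivlMr // => b c.
have := ler_norm M; have := hnorm_ge0 x; have := hnorm_ge0 (u p - x).
have := hnorm_ge0 (v p - y); have := hnorm_ge0 (v p).
move: (hnorm _) (hnorm _) (hnorm _) (hnorm _) b c a A B k0 => r s t q.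
set m := `|M| => b c a A B k0 r0 q0 s0 t0 Mm.
have [E|E] := leP s q.
  have : s * r <= q * r by nra.
  nra.
nra.
Qed.

End InnerProduct.

(** * Riesz representation *)

Lemma invS_small (R : realType) (eps : R) : 0 < eps ->
  exists N, forall p, (N <= p)%N -> p.+1%:R^-1 < eps.
Proof.
move=> e0; have [N hN] : exists N : nat, eps^-1 < N%:R.
  by exists (Num.bound eps^-1); apply: archi_boundP; rewrite invr_ge0 ltW.
exists N => p le; rewrite invf_plt ?posrE ?ltr0n //.
by apply: lt_le_trans hN _; rewrite ler_nat; lia.
Qed.

Lemma fun_choice (A B : Type) (P : A -> B -> Prop) :
  (forall x, exists y, P x y) -> exists f, forall x, P x (f x).
Proof.
move=> ex; exists (fun x => proj1_sig (constructive_indefinite_description _ (ex x))) => x.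
exact: proj2_sig.
Qed.

Section Riesz.
Variables (R : realType) (H : hilbert R) (X : Type).
Implicit Types (s t : seq (R[i] * X)).

(** Lists, possibly with repetitions, play the part of finitely supported families. The target is
    any module, so that with [R[i]^o] the same sum is the value of a functional. *)
Definition comb (V : lmodType R[i]) (v : X -> V) s : V := \sum_(p <- s) p.1 *: v p.2.

Definition scale_comb (a : R[i]) s := [seq (a * p.1, p.2) | p <- s].

Lemma comb_cat (V : lmodType R[i]) (v : X -> V) s t : comb v (s ++ t) = comb v s + comb v t.
Proof. exact: big_cat. Qed.

Lemma comb_scale (V : lmodType R[i]) (v : X -> V) a s :
  comb v (scale_comb a s) = a *: comb v s.
Proof. by rewrite /comb big_map scaler_sumr; apply: eq_bigr => p _; rewrite scalerA. Qed.

Lemma comb1 (V : lmodType R[i]) (v : X -> V) a x : comb v [:: (a, x)] = a *: v x.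
Proof. by rewrite /comb big_seq1. Qed.

Lemma comb_inner (v : X -> H) s y : '[comb v s, y] = comb (fun x => '[v x, y] : R[i]^o) s.
Proof. by rewrite inner_suml; apply: eq_bigr => p _; rewrite innerZl. Qed.

(* The vector is the limit of a sequence minimizing |u|^2 - 2 Re (g u) over the finite
   combinations u. *)
Lemma riesz (v : X -> H) (g : X -> R[i]^o) (M : R) : 0 <= M ->
  (forall s, cmod (comb g s) <= M * hnorm (comb v s)) ->
  exists z, [/\ forall x, '[v x, z] = g x,
    forall y, (forall x, '[v x, y] = 0) -> '[z, y] = 0,
    hnorm z <= M & exists s : nat -> seq (R[i] * X), hcvg (fun n => comb v (s n)) z].
Proof.
move=> M0 bg.
pose J s := hnorm (comb v s) ^+ 2 - 2 * complex.Re (comb g s).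
pose E : classical_sets.set R := fun r => exists s, r = J s.
have lbE s : - M ^+ 2 <= J s.
  have := le_trans (Re_le_cmod _) (bg s); rewrite /J.
  by have := sqr_ge0 (hnorm (comb v s) - M); nra.
have infE : classical_sets.has_inf E.
  split; first by exists (J [::]), [::].
  by exists (- M ^+ 2) => _ [s ->].
have dJ s : inf E <= J s.
  by apply: ge_inf; [case: infE | exists s].
have min_seq n : exists s, J s < inf E + n.+1%:R^-1.
  have i0 : 0 < n.+1%:R^-1 :> R by rewrite invr_gt0 ltr0n.
  by have [_ [s ->] lt] := inf_adherent i0 infE; exists s.
have [s sP] := fun_choice min_seq.
pose u n := comb v (s n).
(* Parallelogram law: [J] at the midpoint of u_n and u_k is still at least the infimum. *)
have u_dist n k : hnorm (u n - u k) ^+ 2 < 2 * (n.+1%:R^-1 + k.+1%:R^-1).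
  have := dJ (scale_comb (2^-1)%:C (s n) ++ scale_comb (2^-1)%:C (s k)).
  rewrite {1}/J !comb_cat !comb_scale -!scalerDr hnormZ cmod_real exprMn real_normK ?num_real //.
  rewrite scaleCE ReRC ReD !hnormD_sqr -/(u n) -/(u k).
  rewrite hnormN innerNr ReN.
  have := sP n; have := sP k; rewrite /J -/(u n) -/(u k).
  move: (hnorm (u n) ^+ 2) (hnorm (u k) ^+ 2) (complex.Re '[_, _]) => a b c.
  rewrite expr2; move: (inf E) (n.+1%:R^-1) (k.+1%:R^-1) => i d1 d2; lra.
have [z zP] : exists z, hcvg u z.
  apply: hcomplete => eps e0.
  have e4 : 0 < eps ^+ 2 / 4 by rewrite divr_gt0 ?exprn_gt0.
  have [N hN] := invS_small e4; exists N => p q /hN hp /hN hq.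
  rewrite -/(hnorm _) -(ltr_pXn2r (ltn0Sn 1)) ?nnegrE ?hnorm_ge0 ?ltW //.
  apply: lt_trans (u_dist p q) _; move: hp hq.
  by move: (p.+1%:R^-1) (q.+1%:R^-1) (eps ^+ 2) => a b c; lra.
have vz x : '[v x, z] = g x.
  apply: (@ccvg_uniq _ (fun n => '[v x, u n])).
    by apply: ccvg_inner => // eps e0; exists 0%N => p _; rewrite subrr hnorm0.
  (* Let w be the error <v x, u_n> - g x. Moving u_n by - rho w^* v x changes [J] by rho^2 |w|^2 |v
     x|^2 - 2 rho |w|^2. As rho |v x|^2 <= 1, this is at most - rho |w|^2, and near-minimality
     bounds the gain by 1 / (n + 1). The summand 1 covers v x = 0. *)
  pose rho := (1 + hnorm (v x) ^+ 2)^-1.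
  have rho0 : 0 < rho by rewrite invr_gt0; have := sqr_ge0 (hnorm (v x)); lra.
  have w_le n : cmod ('[v x, u n] - g x) ^+ 2 * rho <= n.+1%:R^-1.
    set w := _ - _.
    have := dJ (s n ++ scale_comb (- (rho%:C * w^*)) [:: (1, x)]).
    rewrite /J !comb_cat !comb_scale !comb1 !scale1r -/(u n) hnormD_sqr hnormZ.
    rewrite cmodN cmodM cmod_real cmodJ (gtr0_norm rho0) innerZr.
    rewrite scaleCE conjN conjM conj_RC conjK.
    have -> : complex.Re (- (rho%:C * w) * '[u n, v x]) =
              - rho * complex.Re (w^* * '[v x, u n]).
      by rewrite -Re_conj conjM -innerC conjN conjM conj_RC mulNr ReN -mulrA ReRC mulNr.
    have -> : complex.Re (comb g (s n) + - (rho%:C * w^*) * g x) =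
              complex.Re (comb g (s n)) - rho * complex.Re (w^* * g x).
      by rewrite ReD -ReRC -ReN; congr (_ + complex.Re _); ring.
    have : complex.Re (w^* * '[v x, u n]) - complex.Re (w^* * g x) = cmod w ^+ 2.
      by rewrite -ReN -ReD -mulrBr -/w mulrC mul_conj.
    have := sP n; rewrite /J -/(u n).
    have : rho * hnorm (v x) ^+ 2 <= 1.
      by rewrite mulrC ler_pdivrMr; have := sqr_ge0 (hnorm (v x)); lra.
    have := mulr_ge0 (ltW rho0) (sqr_ge0 (cmod w)).
    rewrite !exprMn.
    move: (hnorm (u n) ^+ 2) (hnorm (v x) ^+ 2) (cmod w ^+ 2) n.+1%:R^-1 => a b c d.
    move: (complex.Re _) (complex.Re _) (complex.Re _) => p q r.
    nra.
  move=> eps e0; have [N hN] := invS_small (mulr_gt0 (exprn_gt0 2 e0) rho0).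
  exists N => p /hN lt; have := le_lt_trans (w_le p) lt.
  by rewrite (ltr_pM2r rho0) ltr_pXn2r ?nnegrE ?cmod_ge0 ?ltW.
exists z; split=> //.
- move=> y vy; apply: (@ccvg_uniq _ (fun n => '[u n, y])).
    by apply: ccvg_inner => // eps e0; exists 0%N => p _; rewrite subrr hnorm0.
  move=> eps e0; exists 0%N => p _.
  rewrite comb_inner /comb big1 ?subrr ?cmod0 // => i _.
  by rewrite vy scaler0.
- have [//|lt] := leP (hnorm z) M.
  have z0 : 0 < hnorm z by lra.
  (* If |z - u| < eps then |z|^2 <= eps |z| + M (|z| + eps); this eps makes that inequality fail. *)
  have e0 : 0 < hnorm z * (hnorm z - M) / (hnorm z + M).
    by rewrite divr_gt0 ?mulr_gt0; lra.
  have [N hN] := zP _ e0; have := hN _ (leqnn N).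
  rewrite ltr_pdivlMr; last by lra.
  have := cauchy_schwarz (z - u N) z; rewrite innerBl.
  have := bg (s N); rewrite -/(u N).
  have -> : comb g (s N) = '[u N, z].
    by rewrite comb_inner; apply: eq_bigr => p _; rewrite vz.
  have := cmodD ('[z, z] - '[u N, z]) '[u N, z]; rewrite subrK.
  rewrite inner_hnorm cmod_real (ger0_norm (sqr_ge0 _)).
  have := hnormD (u N - z) z; rewrite subrK hnormBC.
  move: (hnorm _) (hnorm _) (cmod _) (cmod _) z0 lt M0 => a b c d; nra.
- by exists s.
Qed.

End Riesz.

(** * Bounded operators *)

Definition total (R : realType) (H : hilbert R) (X : Type) (v : X -> H) : Prop :=
  forall y, (forall x, '[v x, y] = 0) -> y = 0.

Section Operators.
Variable R : realType.
Implicit Types H K L : hilbert R.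

Section Linear.
Variables (H K : hilbert R) (A : H -> K).
Hypothesis linA : is_linear A.

Lemma linearD_op x y : A (x + y) = A x + A y.
Proof. by rewrite -[x]scale1r linA !scale1r. Qed.

Lemma linear0_op : A 0 = 0.
Proof. by apply: (addrI (A 0)); rewrite -linearD_op !addr0. Qed.

Lemma linearZ_op a x : A (a *: x) = a *: A x.
Proof. by rewrite -[a *: x]addr0 linA linear0_op addr0. Qed.

Lemma linearN_op x : A (- x) = - A x.
Proof. by rewrite -scaleN1r linearZ_op scaleN1r. Qed.

Lemma linear_sum_op (I : Type) (r : seq I) (P : pred I) (F : I -> H) :
  A (\sum_(i <- r | P i) F i) = \sum_(i <- r | P i) A (F i).
Proof. by elim/big_rec2: _ => [|i u v _ <-]; rewrite ?linear0_op ?linearD_op. Qed.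

Lemma linear_comb_op (X : Type) (v : X -> H) s : A (comb v s) = comb (A \o v) s.
Proof. by rewrite /comb linear_sum_op; apply: eq_bigr => p _; rewrite linearZ_op. Qed.

End Linear.

Lemma bounded_opP H K (A : H -> K) : bounded_op A ->
  exists2 M, 0 <= M & forall x, hnorm (A x) <= M * hnorm x.
Proof.
move=> [_ [M bM]]; exists `|M| => // x; apply: le_trans (bM x) _.
by rewrite ler_wpM2r ?hnorm_ge0 ?ler_norm.
Qed.

Lemma bounded_id H : bounded_op (@id H).
Proof. by split=> //; exists 1 => x; rewrite mul1r. Qed.

Lemma bounded_comp H K L (A : K -> L) (B : H -> K) :
  bounded_op A -> bounded_op B -> bounded_op (A \o B).
Proof.
move=> bA bB; split; first by move=> a x y /=; rewrite (proj1 bB) (proj1 bA).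
have [M M0 hM] := bounded_opP bA; have [N _ hN] := bounded_opP bB.
exists (M * N) => x /=; apply: le_trans (hM _) _.
by rewrite -mulrA ler_wpM2l.
Qed.

Lemma bounded_add H K (A B : H -> K) :
  bounded_op A -> bounded_op B -> bounded_op (fun x => A x + B x).
Proof.
move=> bA bB; split.
  by move=> a x y; rewrite (proj1 bA) (proj1 bB) scalerDr addrACA.
have [M _ hM] := bounded_opP bA; have [N _ hN] := bounded_opP bB.
exists (M + N) => x; apply: le_trans (hnormD _ _) _.
by rewrite mulrDl lerD.
Qed.

Lemma bounded_scale H K (A : H -> K) a : bounded_op A -> bounded_op (fun x => a *: A x).
Proof.
move=> bA; split.
  by move=> b x y; rewrite (proj1 bA) scalerDr !scalerA mulrC.
have [M _ hM] := bounded_opP bA; exists (cmod a * M) => x.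
by rewrite hnormZ -mulrA ler_wpM2l ?cmod_ge0.
Qed.

Lemma bounded_sum H K (I : Type) (r : seq I) (F : I -> H -> K) :
  (forall i, bounded_op (F i)) -> bounded_op (fun x => \sum_(i <- r) F i x).
Proof.
move=> bF; elim: r => [|i r [linr [M hM]]].
  split; first by move=> a x y; rewrite !big_nil scaler0 addr0.
  by exists 0 => x; rewrite big_nil hnorm0 mul0r.
have := bounded_add (bF i) (conj linr (ex_intro _ M hM)) => -[l [N hN]].
split; first by move=> a x y; rewrite !big_cons; apply: l.
by exists N => x; rewrite big_cons; apply: hN.
Qed.

Lemma hcvg_image H K (A : H -> K) u x :
  bounded_op A -> hcvg u x -> hcvg (fun n => A (u n)) (A x).
Proof.
move=> [linA [M bM]] cu eps e0.
have k0 : 0 < `|M| + 1 by have := normr_ge0 M; lra.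
have [N h] := cu _ (divr_gt0 e0 k0); exists N => p /h.
rewrite ltr_pdivlMr // => lt.
have -> : A (u p) - A x = A (u p - x).
  by rewrite addrC -scaleN1r -linA scaleN1r addrC.
have := bM (u p - x); have := ler_norm M; have := hnorm_ge0 (u p - x); nra.
Qed.

Lemma adjoint_exists H K (A : H -> K) : bounded_op A ->
  exists B : K -> H, forall x y, '[A x, y] = '[x, B y].
Proof.
move=> bA; have [M M0 hM] := bounded_opP bA.
suff ex y : exists z, forall x, '[A x, y] = '[x, z].
  by have [B hB] := fun_choice ex; exists B => x y; apply: hB.
have M1 : 0 <= M * hnorm y by rewrite mulr_ge0 ?hnorm_ge0.
have [s|z [hz _ _ _]] := @riesz _ H H id (fun x => '[A x, y]) _ M1.
  have -> : comb (fun x => '[A x, y] : R[i]^o) s = '[A (comb id s), y].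
    by rewrite (linear_comb_op (proj1 bA)) comb_inner.
  apply: le_trans (cauchy_schwarz _ _) _.
  by rewrite mulrAC ler_wpM2r ?hnorm_ge0.
by exists z => x; rewrite hz.
Qed.

Lemma adjoint_bounded H K (A : H -> K) (B : K -> H) : bounded_op A ->
  (forall x y, '[A x, y] = '[x, B y]) -> bounded_op B.
Proof.
move=> bA AB; split.
  move=> a x y; apply: inner_ext => z; rewrite innerC [RHS]innerC; congr (_^*).
  by rewrite -AB !innerDr !innerZr -!AB.
have [M M0 hM] := bounded_opP bA; exists M => x.
have [->|n0] := eqVneq (hnorm (B x)) 0; first by rewrite mulr_ge0 ?hnorm_ge0.
have p0 : 0 < hnorm (B x) by rewrite lt0r n0 hnorm_ge0.
rewrite -(ler_pM2l p0).
have := cauchy_schwarz (A (B x)) x; rewrite AB inner_hnorm cmod_real ger0_norm ?sqr_ge0 //.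
have := hM (B x); have := hnorm_ge0 x; move: (hnorm _) (hnorm _) (hnorm _) => a b c; nra.
Qed.

Lemma adjP H (A : H -> H) : bounded_op A -> is_adjoint A (adj A).
Proof.
move=> bA; rewrite /adj; case: excluded_middle_informative => [ex|[]].
  exact: proj2_sig.
exact: adjoint_exists.
Qed.

Lemma adj_bounded H (A : H -> H) : bounded_op A -> bounded_op (adj A).
Proof. by move=> bA; apply: (adjoint_bounded bA); apply: adjP. Qed.

Lemma adj_sym H (A B : H -> H) : is_adjoint A B -> is_adjoint B A.
Proof. by move=> AB x y; rewrite innerC -AB -innerC. Qed.

Lemma total_ext H (X : Type) (v : X -> H) x y : total v ->
  (forall w, '[v w, x] = '[v w, y]) -> x = y.
Proof.
move=> tv E; apply/eqP; rewrite -subr_eq0; apply/eqP/tv => w.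
by rewrite innerBr E subrr.
Qed.

(** The Riesz vector of w |-> <v w, x> is a limit of combinations by construction, and totality
    identifies it with x. *)
Lemma total_dense H (X : Type) (v : X -> H) x : total v ->
  exists s : nat -> seq (R[i] * X), hcvg (fun n => comb v (s n)) x.
Proof.
move=> tv; have [s|z [hz _ _ [s sP]]] := @riesz _ H X v (fun w => '[v w, x]) _ (hnorm_ge0 x).
  by rewrite -comb_inner mulrC cauchy_schwarz.
by exists s; rewrite (total_ext tv (x := x) (y := z)) // => w; rewrite hz.
Qed.

(* B is the adjoint of [v x |-> v' x]; its range lies in the closed span of v, expressed as
   the double orthogonal. *)
Lemma bounded_transport H K (X : Type) (v : X -> H) (v' : X -> K) (M : R) : 0 <= M ->
  (forall s, hnorm (comb v' s) <= M * hnorm (comb v s)) ->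
  exists B : K -> H, [/\ bounded_op B, forall x y, '[v x, B y] = '[v' x, y] &
    forall y z, (forall x, '[v x, z] = 0) -> '[B y, z] = 0].
Proof.
move=> M0 bv.
have ex y : exists b, [/\ forall x, '[v x, b] = '[v' x, y],
    forall z, (forall x, '[v x, z] = 0) -> '[b, z] = 0 & hnorm b <= M * hnorm y].
  have M1 : 0 <= M * hnorm y by rewrite mulr_ge0 ?hnorm_ge0.
  have [s|z [h1 h2 h3 _]] := @riesz _ H X v (fun x => '[v' x, y]) _ M1; last by exists z.
  rewrite -comb_inner; apply: le_trans (cauchy_schwarz _ _) _.
  by rewrite mulrAC ler_wpM2r ?hnorm_ge0.
have [B hB] := fun_choice ex; exists B; split.
- split; last by exists M => y; case: (hB y).
  move=> a x y; apply/eqP; rewrite -subr_eq0; apply/eqP/hinner_eq0.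
  set d := _ - _.
  have vd w : '[v w, d] = 0.
    rewrite /d innerBr innerDr innerZr.
    by case: (hB x) => -> _ _; case: (hB y) => -> _ _; case: (hB (a *: x + y)) => -> _ _;
      rewrite innerDr innerZr subrr.
  rewrite {1}/d innerBl innerDl innerZl.
  by case: (hB x) => _ -> // _; case: (hB y) => _ -> // _; case: (hB (a *: x + y)) => _ -> // _;
    rewrite mulr0 addr0 subr0.
- by move=> x y; case: (hB y).
- by move=> y; case: (hB y).
Qed.

End Operators.

(** * Cauchy's estimate *)

Section CoefficientBound.
Variable R : realType.

Lemma prim_root_exists (C : numClosedFieldType) n : (0 < n)%N ->
  exists z : C, n.-primitive_root z.
Proof.
pose p : {poly C} := 'X^n - 1; have [r Dp] := closed_field_poly_normal p.
move=> n0; rewrite (monicP _) ?monicXnsubC // scale1r in Dp.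
have rn1 : all n.-unity_root r by apply/allP => z; rewrite -root_prod_XsubC -Dp.
have sz_r : (n < (size r).+1)%N by rewrite -(size_prod_XsubC r id) -Dp size_XnsubC.
have [|z] := hasP (has_prim_root n0 rn1 _ sz_r); last by exists z.
by rewrite -separable_prod_XsubC -Dp separable_Xn_sub_1 // pnatr_eq0 -lt0n.
Qed.

Lemma prim_root_sum (F : fieldType) n (z : F) k : n.-primitive_root z ->
  \sum_(t < n) z ^+ (t * k) = if (n %| k)%N then n%:R else 0.
Proof.
move=> pz; case: ifP => dk.
  rewrite (eq_bigr (fun=> 1)) ?sumr_const ?card_ord // => t _.
  by apply/eqP; rewrite -(prim_order_dvd pz) dvdn_mull.
have zk : z ^+ k - 1 != 0 by rewrite subr_eq0 -(prim_order_dvd pz) dk.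
apply: (mulfI zk); rewrite mulr0 (eq_bigr (fun t : 'I_n => (z ^+ k) ^+ t)).
  by rewrite -subrX1 -exprM mulnC exprM (prim_expr_order pz) expr1n subrr.
by move=> t _; rewrite -exprM mulnC.
Qed.

(* Cauchy's estimate, with the circle replaced by roots of unity. *)
Lemma coef1_bound (p : {poly R[i]}) (rho B : R) : 0 <= rho ->
  (forall a, cmod a = rho -> cmod p.[a] <= B) -> rho * cmod p`_1 <= B.
Proof.
(* This n exceeds every exponent j that occurs, so averaging against z^(t (n - 1)) = z^(-t) keeps j
   = 1 alone. *)
move=> r0 bp; pose n := (size p).+2.
have [z pz] := @prim_root_exists R[i] n isT.
have z1 : cmod z = 1.
  apply/eqP; rewrite -(@eqrXn2 _ n) ?cmod_ge0 ?ler01 // expr1n -cmodX.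
  by rewrite (prim_expr_order pz) cmod1.
have E : \sum_(t < n) z ^+ (t * n.-1) * p.[rho%:C * z ^+ t] = n%:R * (rho%:C * p`_1).
  under eq_bigr => t _ do rewrite (horner_coef_wide _ (leqnSn _)) mulr_sumr.
  rewrite exchange_big /= (eq_bigr (fun j : 'I_(size p).+1 =>
    p`_j * rho%:C ^+ j * (if (n %| j + n.-1)%N then n%:R else 0))) => [|j _].
    have [s0|sn0] := eqVneq (size p) 0%N.
      have -> : p = 0 by apply/eqP; rewrite -size_poly_eq0 s0.
      by rewrite coef0 !mulr0 big1 // => j _; rewrite coef0 !mul0r.
    have lt1 : (1 < (size p).+1)%N by rewrite ltnS lt0n.
    rewrite (bigD1 (Ordinal lt1)) //= big1 ?addr0.
      by rewrite /n dvdnn; ring.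
    move=> j; rewrite -val_eqE /= => j1.
    have -> : (n %| j + n.-1)%N = false; last by rewrite mulr0.
    apply/negbTE; have := ltn_ord j; move: j1; rewrite /n; case: (val j) => [|[|k]] //= _ lt.
      by rewrite add0n gtnNdvd.
    have -> : (k.+2 + (size p).+1 = k.+1 + (size p).+2)%N by lia.
    by rewrite dvdn_addl ?dvdnn // gtnNdvd //; lia.
  rewrite -(prim_root_sum _ pz) mulr_sumr; apply: eq_bigr => t _.
  rewrite exprMn -exprM mulnDr exprD; ring.
have n0 : 0 < n%:R :> R by rewrite ltr0n.
have := cmod_sum (index_enum 'I_n) predT (fun t => z ^+ (t * n.-1) * p.[rho%:C * z ^+ t]).
rewrite E !cmodM cmod_real (ger0_norm r0) -(rmorph_nat (real_complex R)) cmod_real.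
rewrite normr_nat => le; rewrite -(ler_pM2l n0); apply: le_trans le _.
apply: (@le_trans _ _ (\sum_(t < n) B)); last by rewrite sumr_const card_ord mulr_natl.
apply: ler_sum => t _; rewrite cmodM cmodX z1 expr1n mul1r; apply: bp.
by rewrite cmodM cmodX z1 expr1n mulr1 cmod_real ger0_norm.
Qed.

End CoefficientBound.

(** * Fuglede's theorem *)

Section PowerEstimates.
Variable R : realType.

Lemma pow_le_inv (t : R) n : 0 <= t -> (1 + t) ^+ n * (1 - n%:R * t) <= 1.
Proof.
move=> t0; elim: n => [|n IH]; first by rewrite expr0 mul0r subr0 mulr1.
apply: le_trans IH; rewrite exprSr -mulrA ler_wpM2l ?exprn_ge0 ?addr_ge0 //.
by rewrite -natr1; have : 0 <= n%:R :> R by []; nra.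
Qed.

Lemma pow_le_2 (t : R) n : 0 <= t -> n%:R * t <= 2^-1 ->
  (1 + t) ^+ n <= 1 + 2 * (n%:R * t).
Proof.
move=> t0 h; have := pow_le_inv n t0; have := mulr_ge0 (ler0n R n) t0.
have : 0 <= (1 + t) ^+ n by rewrite exprn_ge0 // addr_ge0.
move: ((1 + t) ^+ n) (n%:R * t) h => a b h; nra.
Qed.

(** (1 + s/n)^n stays bounded, as e^s suggests, while (1 + s^2/n^2)^n - 1 is of order s^2/n. The
    choice n = j k separates the two: (1 + s/n)^j <= 2 as soon as k >= 2 s, so the first power is at
    most 2^k whatever j is, and j is then taken large against the square of 2^k. *)
Lemma pow_estimates (s : R) : 0 <= s -> exists n : nat,
  [/\ (0 < n)%N, (1 + (s / n%:R) ^+ 2) ^+ n <= 2 &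
    (1 + s / n%:R) ^+ n * ((1 + (s / n%:R) ^+ 2) ^+ n - 1) * (1 + s / n%:R) ^+ n <= 1].
Proof.
move=> s0; pose k := (Num.bound (2 * s)).+1.
have hk : 2 * s < k%:R.
  have s2 : 0 <= 2 * s by rewrite mulr_ge0.
  by apply: lt_trans (archi_boundP s2) _; rewrite ltr_nat.
pose K : R := (2 ^+ k) ^+ 2.
have K1 : 1 <= K by rewrite !exprn_ege1 // ler1n.
pose j := (Num.bound (2 * s ^+ 2 * K)).+1.
have hj : 2 * s ^+ 2 * K < j%:R.
  have s2 : 0 <= 2 * s ^+ 2 * K by rewrite mulr_ge0 ?(le_trans ler01 K1) // mulr_ge0 ?sqr_ge0.
  by apply: lt_trans (archi_boundP s2) _; rewrite ltr_nat.
exists (j * k)%N; set n := (j * k)%N.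
have j0 : 0 < j%:R :> R by rewrite ltr0n.
have k0 : 0 < k%:R :> R by rewrite ltr0n.
have k1 : 1 <= k%:R :> R by rewrite ler1n.
have n0 : 0 < n%:R :> R by rewrite ltr0n muln_gt0.
have sn0 : 0 <= s / n%:R by rewrite divr_ge0 // ltW.
have p_le : (1 + s / n%:R) ^+ n <= 2 ^+ k.
  rewrite {2}/n exprM lerXn2r ?nnegrE ?exprn_ge0 ?addr_ge0 //.
  have E : j%:R * (s / n%:R) = s / k%:R.
    by rewrite /n natrM; field; rewrite !gt_eqF.
  have h : s / k%:R <= 2^-1.
    by rewrite ler_pdivrMr //; move: hk; move: (k%:R : R) => d; lra.
  apply: le_trans (pow_le_2 sn0 _) _; rewrite E //.
  by move: h; move: (s / k%:R) => d; lra.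
have q0 : 0 <= (s / n%:R) ^+ 2 by rewrite sqr_ge0.
have E : n%:R * (s / n%:R) ^+ 2 = s ^+ 2 / n%:R by field; rewrite gt_eqF.
have h : s ^+ 2 / n%:R * K <= 2^-1.
  rewrite mulrAC ler_pdivrMr // /n natrM.
  have : j%:R <= j%:R * k%:R :> R by rewrite ler_peMr // ltW.
  by move: hj; nra.
have d0 : 0 <= s ^+ 2 / n%:R by rewrite divr_ge0 ?sqr_ge0 // ltW.
have h1 : s ^+ 2 / n%:R <= 2^-1 by move: h d0; move: (s ^+ 2 / n%:R) => d; nra.
have q_le : (1 + (s / n%:R) ^+ 2) ^+ n <= 1 + 2 * (s ^+ 2 / n%:R).
  by rewrite -E; apply: pow_le_2; rewrite ?E.
split; first by rewrite muln_gt0.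
  by apply: le_trans q_le _; move: h1; move: (s ^+ 2 / n%:R) => d; lra.
have q1 : 1 <= (1 + (s / n%:R) ^+ 2) ^+ n by rewrite exprn_ege1 // lerDl.
have p0 : 0 <= (1 + s / n%:R) ^+ n by rewrite exprn_ge0 // addr_ge0.
have pp : (1 + s / n%:R) ^+ n * (1 + s / n%:R) ^+ n <= K.
  by rewrite /K expr2; apply: ler_pM.
move: ((1 + (s / n%:R) ^+ 2) ^+ n) ((1 + s / n%:R) ^+ n) q_le q1 p0 pp h d0.
move: (s ^+ 2 / n%:R) => d q p q_le q1 p0 pp h d0.
rewrite mulrAC; nra.
Qed.

End PowerEstimates.

Section Fuglede.
Variables (R : realType) (H : hilbert R).
Implicit Types (A B : H -> H) (c : R[i]).

(** Its n-th iterate (1 + c A)^n stands in for the exponential of n c A and is a polynomial in c. *)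
Definition addid c A (y : H) : H := y + c *: A y.

Lemma iter_commute (T : Type) (f g : T -> T) n k x : (forall y, f (g y) = g (f y)) ->
  iter n f (iter k g x) = iter k g (iter n f x).
Proof.
move=> fg; have gf y : iter n f (g y) = g (iter n f y).
  by elim: n => [|n IH] //=; rewrite IH fg.
by elim: k => [|k IH] //=; rewrite gf IH.
Qed.

Lemma iter_commute1 (T : Type) (f g : T -> T) n x : (forall y, f (g y) = g (f y)) ->
  iter n f (g x) = g (iter n f x).
Proof. exact: (@iter_commute _ f g n 1). Qed.

Lemma iter_adjoint A B n x y : is_adjoint A B -> '[iter n A x, y] = '[x, iter n B y].
Proof. by move=> AB; elim: n x => [|n IH] x //; rewrite iterSr IH AB. Qed.

Lemma addid_adjoint c A B : is_adjoint A B -> is_adjoint (addid c A) (addid c^* B).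
Proof. by move=> AB x y; rewrite innerDl innerDr innerZl innerZr conjK AB. Qed.

Lemma addid_commute a b A B x : is_linear A -> is_linear B ->
  (forall y, A (B y) = B (A y)) -> addid a A (addid b B x) = addid b B (addid a A x).
Proof.
move=> lA lB AB; rewrite /addid (linearD_op lA) (linearZ_op lA) (linearD_op lB).
by rewrite (linearZ_op lB) AB !scalerDr !scalerA (mulrC b a) -!addrA; congr (_ + _); rewrite addrCA.
Qed.

Lemma addid_opp c A x : is_linear A ->
  addid c A (addid (- c) A x) = addid (- c ^+ 2) (A \o A) x.
Proof.
move=> lA; rewrite /addid (linearD_op lA) (linearZ_op lA) scalerDr scalerA /=.
by rewrite addrA scaleNr subrK mulrN expr2.
Qed.

Lemma addid_iterE c A n x : is_linear A ->
  iter n (addid c A) x = \sum_(k < n.+1) (('C(n, k))%:R * c ^+ k) *: iter k A x.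
Proof.
move=> lA; elim: n => [|n IH]; first by rewrite big_ord_recl big_ord0 /= mulr1 scale1r addr0.
rewrite iterS IH {1}/addid (linear_sum_op lA) scaler_sumr.
have -> : \sum_(k < n.+1) ('C(n, k)%:R * c ^+ k) *: iter k A x =
    x + \sum_(k < n.+1) ('C(n, k.+1)%:R * c ^+ k.+1) *: iter k.+1 A x.
  rewrite big_ord_recl [in RHS]big_ord_recr /= (@bin_small n n.+1) // mul0r scale0r.
  by rewrite addr0 bin0 mul1r scale1r.
rewrite [in RHS]big_ord_recl /= mul1r scale1r -addrA -big_split /=; congr (_ + _).
apply: eq_bigr => k _; rewrite (linearZ_op lA) scalerA -scalerDl; congr (_ *: _).
by rewrite /bump /= !add1n binS natrD exprS; ring.
Qed.

Lemma addid_norm c A M n x : 0 <= M -> (forall y, hnorm (A y) <= M * hnorm y) ->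
  hnorm (iter n (addid c A) x) <= (1 + cmod c * M) ^+ n * hnorm x.
Proof.
move=> M0 bA; elim: n => [|n IH]; first by rewrite expr0 mul1r.
rewrite iterS exprS -mulrA; apply: le_trans (hnormD _ _) _; rewrite hnormZ.
have h : cmod c * hnorm (A (iter n (addid c A) x)) <= cmod c * M * hnorm (iter n (addid c A) x).
  by rewrite -mulrA ler_wpM2l ?cmod_ge0.
apply: le_trans (lerD (lexx _) h) _; rewrite -[X in X + _]mul1r -mulrDl ler_wpM2l //.
by rewrite addr_ge0 ?mulr_ge0 ?cmod_ge0.
Qed.

Lemma addid_dist c A M n x : 0 <= M -> (forall y, hnorm (A y) <= M * hnorm y) ->
  hnorm (iter n (addid c A) x - x) <= ((1 + cmod c * M) ^+ n - 1) * hnorm x.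
Proof.
move=> M0 bA; elim: n => [|n IH]; first by rewrite /= !subrr hnorm0 mul0r.
rewrite iterS {1}/addid addrAC; apply: le_trans (hnormD _ _) _; rewrite hnormZ.
have h : cmod c * hnorm (A (iter n (addid c A) x)) <=
    cmod c * M * ((1 + cmod c * M) ^+ n * hnorm x).
  apply: le_trans (ler_wpM2l (cmod_ge0 c) (bA _)) _.
  by rewrite [X in X <= _]mulrA ler_wpM2l ?mulr_ge0 ?cmod_ge0 ?addid_norm.
apply: le_trans (lerD IH h) _; rewrite exprS le_eqVlt; apply/orP; left; apply/eqP; ring.
Qed.

Variables (N N' X : H -> H).
Hypotheses (linN : is_linear N) (linN' : is_linear N') (linX : is_linear X).
Hypotheses (adjN : is_adjoint N N') (normN : forall x, N (N' x) = N' (N x)).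
Hypotheses (commX : forall x, X (N x) = N (X x)).

Let U a n := iter n (addid a N').
Let V a n := iter n (addid a N).

(** For exponentials the right side would be x. The factor (1 - a^2 N'^2)^n is the defect that
    [pow_estimates] controls. *)
Lemma fuglede_UU a n x : U a n (U (- a) n x) = iter n (addid (- a ^+ 2) (N' \o N')) x.
Proof.
elim: n x => [|n IH] x //; rewrite iterS -IH /U iterSr [iter n.+1 (addid (- a) N') x]iterS.
rewrite addid_opp //; apply: iter_commute1 => y.
apply: addid_commute => //.
by move=> c u v /=; rewrite !linN'.
Qed.

Lemma fuglede_UV a n k c x : U a n (V c k x) = V c k (U a n x).
Proof. by apply: iter_commute => y; apply: addid_commute. Qed.

Lemma fuglede_XV a n x : X (V a n x) = V a n (X x).
Proof.
symmetry; apply: iter_commute1 => y.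
by rewrite /addid (linearD_op linX) (linearZ_op linX) commX.
Qed.

Lemma fuglede_adjV a n x y : '[V a n x, y] = '[x, U a^* n y].
Proof. by apply/iter_adjoint/addid_adjoint. Qed.

Lemma fuglede_adjU a n x y : '[U a n x, y] = '[x, V a^* n y].
Proof. by apply/iter_adjoint/addid_adjoint/adj_sym. Qed.

(** As X commutes with N, the power of 1 + a^* N passes through X and becomes, on the other side, a
    power of 1 + a N', which cancels that of 1 - a N' up to the defect. *)
Lemma fuglede_sq a n x y : '[X (V a^* n (U (- a) n x)), V a^* n (U (- a) n y)] =
  '[X (U (- a) n x), iter n (addid (- a ^+ 2) (N' \o N')) (V a^* n y)].
Proof. by rewrite fuglede_XV fuglede_adjV conjK -fuglede_UV fuglede_UU. Qed.

Lemma bound_sq (A : H -> H) (M : R) : 0 <= M -> (forall y, hnorm (A y) <= M * hnorm y) ->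
  forall y, hnorm ((A \o A) y) <= M ^+ 2 * hnorm y.
Proof.
by move=> M0 bA y /=; apply: le_trans (bA _) _; rewrite expr2 -mulrA ler_wpM2l.
Qed.

End Fuglede.

Section FugledeTheorem.
Variables (R : realType) (H : hilbert R).

(* The operator P = (1 + a^* N)^n (1 - a N')^n is nearly unitary: P^* P is the product of
   (1 - a^2 N'^2)^n and its adjoint. *)
Lemma fuglede_unitary (N N' : H -> H) (M : R) a n x :
  is_linear N -> is_linear N' -> is_adjoint N N' -> (forall x, N (N' x) = N' (N x)) ->
  0 <= M -> (forall x, hnorm (N x) <= M * hnorm x) ->
  (forall x, hnorm (N' x) <= M * hnorm x) ->
  hnorm (iter n (addid a^* N) (iter n (addid (- a) N') x)) <=
    (1 + (cmod a * M) ^+ 2) ^+ n * hnorm x.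
Proof.
move=> lN lN' aN cN M0 bN bN'; set q := _ ^+ n.
have q0 : 0 <= q by rewrite exprn_ge0 // addr_ge0 ?sqr_ge0.
rewrite -(ler_pXn2r (ltn0Sn 1)) ?nnegrE ?mulr_ge0 ?hnorm_ge0 //.
rewrite hnorm_sqr (fuglede_adjV aN) conjK.
rewrite (fuglede_adjU aN) rmorphN /=.
rewrite (fuglede_UV lN lN' cN) (fuglede_UU lN').
have := fuglede_UU lN (- a^*) n (iter n (addid (- a ^+ 2) (N' \o N')) x).
rewrite opprK => ->.
apply: le_trans (Re_le_cmod _) _; apply: le_trans (cauchy_schwarz _ _) _.
have E b : cmod (- b ^+ 2) * M ^+ 2 = (cmod b * M) ^+ 2 by rewrite cmodN cmodX exprMn.
have h1 := addid_norm (- a ^+ 2) n x (sqr_ge0 M) (bound_sq M0 bN').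
have h2 := addid_norm (- (- a^*) ^+ 2) n
  (iter n (addid (- a ^+ 2) (N' \o N')) x) (sqr_ge0 M) (bound_sq M0 bN).
rewrite !E cmodN cmodJ -/q in h1 h2.
apply: le_trans (ler_wpM2l (hnorm_ge0 x) (le_trans h2 (ler_wpM2l q0 h1))) _.
by rewrite le_eqVlt; apply/orP; left; apply/eqP; ring.
Qed.

Lemma sum_antidiag1 (F : nat -> nat -> R[i]) n :
  \sum_(k < n.+2) \sum_(l < n.+2) F k l * (1 == k + l)%N%:R = F 0 1 + F 1 0.
Proof.
have h k : \sum_(l < n.+2) F k l * (1 == k + l)%N%:R =
    (k == 0)%N%:R * F 0 1 + (k == 1)%N%:R * F 1 0.
  rewrite (big_ord_recl n.+1) (big_ord_recl n) big1 => [|l _]; last first.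
    by rewrite (_ : (1 == _)%N = false) ?mulr0 //; apply/eqP; rewrite /= /bump; lia.
  by case: k => [|[|k]]; rewrite /= ?mulr0 ?mulr1 ?mul0r ?mul1r ?add0r ?addr0.
under eq_bigr => k _ do rewrite h.
rewrite (big_ord_recl n.+1) (big_ord_recl n) big1 => [|k _].
  by rewrite /= !mul0r !mul1r addr0 add0r addr0.
by rewrite /= !mul0r addr0.
Qed.

(* With a = z / n, the form <X P x, P y> is bounded uniformly on |z| = r and close to the polynomial
   <X (1 - a N')^n x, (1 + a^* N)^n y> in a, whose linear coefficient is n <(N' X - X N') x, y>;
   Cauchy's estimate and r -> oo make this coefficient vanish. *)
Theorem fuglede (N N' X : H -> H) :
  bounded_op N -> bounded_op X -> is_adjoint N N' ->
  (forall x, N (N' x) = N' (N x)) -> (forall x, X (N x) = N (X x)) ->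
  forall x, X (N' x) = N' (X x).
Proof.
move=> boN boX aN cN cX x.
have boN' := adjoint_bounded boN aN.
have lN := proj1 boN; have lN' := proj1 boN'; have lX := proj1 boX.
have [M [M0 bN bN']] : exists M, [/\ 0 <= M, forall x, hnorm (N x) <= M * hnorm x &
    forall x, hnorm (N' x) <= M * hnorm x].
  have [M1 h1 b1] := bounded_opP boN; have [M2 h2 b2] := bounded_opP boN'.
  exists (M1 + M2); split; first exact: addr_ge0.
    by move=> z; apply: le_trans (b1 z) _; rewrite ler_wpM2r ?hnorm_ge0 ?lerDl.
  by move=> z; apply: le_trans (b2 z) _; rewrite ler_wpM2r ?hnorm_ge0 ?lerDr.
have [B B0 bX] := bounded_opP boX.
apply: inner_ext => y; apply/esym/eqP; rewrite -subr_eq0 -innerBl.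
set D := '[_, y]; pose K := B * hnorm x * hnorm y.
have K0 : 0 <= K by rewrite !mulr_ge0 ?hnorm_ge0.
suff main r : 0 < r -> r * cmod D <= 5 * K.
  rewrite -cmod_eq0; apply/eqP/le_anti; rewrite cmod_ge0 andbT leNgt; apply/negP => D0.
  have r0 : 0 < (5 * K + 1) / cmod D by rewrite divr_gt0 //; lra.
  by have := main _ r0; rewrite divfK ?gt_eqF //; lra.
move=> r0; have [[|n] [// _ q_le pq_le]] := pow_estimates (mulr_ge0 (ltW r0) M0).
pose F k l := ('C(n.+1, k)%:R * (-1) ^+ k) * 'C(n.+1, l)%:R * '[X (iter k N' x), iter l N y].
(* The second slot is conjugate-linear, so the parameter a^* of the power of N turns into a and the
   form is a polynomial in a. *)
pose phi : {poly R[i]} := \sum_(k < n.+2) \sum_(l < n.+2) F k l *: 'X^(k + l).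
have phiE a : phi.[a] =
    '[X (iter n.+1 (addid (- a) N') x), iter n.+1 (addid a^* N) y].
  rewrite !addid_iterE // (linear_sum_op lX) inner_suml /phi horner_sum.
  apply: eq_bigr => k _; rewrite inner_sumr horner_sum; apply: eq_bigr => l _.
  rewrite hornerZ hornerXn (linearZ_op lX) innerZl innerZr conjM.
  by rewrite rmorph_nat rmorphXn /= conjCK exprNn exprD /F; ring.
have phi1 : phi`_1 = n.+1%:R * D.
  rewrite /phi coef_sum; under eq_bigr => k _ do
    (rewrite coef_sum; under eq_bigr => l _ do rewrite coefZ coefXn).
  rewrite (sum_antidiag1 F) /F /= bin0 bin1 /D innerBl (adj_sym aN); ring.
have n0 : 0 < n.+1%:R :> R by rewrite ltr0n.
have rn0 : 0 <= r / n.+1%:R by rewrite divr_ge0 // ltW.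
have := @coef1_bound R phi (r / n.+1%:R) (5 * K) rn0.
rewrite phi1 cmodM -(rmorph_nat (real_complex R)) cmod_real normr_nat mulrA divfK ?gt_eqF //.
apply=> a am; rewrite phiE.
have am' : cmod a * M = r * M / n.+1%:R by rewrite am mulrAC.
set u := iter _ _ x; set v := iter _ _ y.
set w := iter n.+1 (addid (- a ^+ 2) (N' \o N')) v.
have -> : '[X u, v] = '[X u, w] - '[X u, w - v] by rewrite innerBr; ring.
apply: le_trans (cmodD _ _) _; rewrite cmodN.
(* 4 = 2 * 2 comes from the two nearly unitary factors, each of norm at most 2; the last K bounds
   the defect. *)
have -> : 5 * K = 4 * K + K by ring.
apply: lerD.
  rewrite -(fuglede_sq lN lN' lX aN cN cX) (le_trans (cauchy_schwarz _ _)) //.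
  apply: le_trans (ler_wpM2r (hnorm_ge0 _) (bX _)) _.
  have hx := fuglede_unitary a n.+1 x lN lN' aN cN M0 bN bN'.
  have hy := fuglede_unitary a n.+1 y lN lN' aN cN M0 bN bN'.
  rewrite am' in hx hy.
  have gx : hnorm (iter n.+1 (addid a^* N) (iter n.+1 (addid (- a) N') x)) <= 2 * hnorm x.
    by apply: le_trans hx _; rewrite ler_wpM2r ?hnorm_ge0.
  have gy : hnorm (iter n.+1 (addid a^* N) (iter n.+1 (addid (- a) N') y)) <= 2 * hnorm y.
    by apply: le_trans hy _; rewrite ler_wpM2r ?hnorm_ge0.
  have -> : 4 * K = B * ((2 * hnorm x) * (2 * hnorm y)) by rewrite /K; ring.
  by rewrite -[X in X <= _]mulrA ler_wpM2l // ler_pM ?hnorm_ge0.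
apply: le_trans (cauchy_schwarz _ _) _.
have h1 := addid_norm (- a) n.+1 x M0 bN'.
have h2 := addid_norm a^* n.+1 y M0 bN.
have h3 := addid_dist (- a ^+ 2) n.+1 v (sqr_ge0 M) (bound_sq M0 bN').
rewrite cmodN cmodJ -/u -/v -/w am' in h1 h2.
rewrite cmodN cmodX -exprMn am' -/w in h3.
move: pq_le h1 h2 h3; set p := _ ^+ n.+1; set q := _ ^+ n.+1 => pq_le h1 h2 h3.
have p0 : 0 <= p by rewrite exprn_ge0 // addr_ge0 // divr_ge0 // mulr_ge0 // ltW.
have q0 : 0 <= q - 1 by rewrite subr_ge0 exprn_ege1 // lerDl sqr_ge0.
apply: le_trans (ler_pM (hnorm_ge0 _) (hnorm_ge0 _) (le_trans (bX u) (ler_wpM2l B0 h1))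
  (le_trans h3 (ler_wpM2l q0 h2))) _.
have -> : B * (p * hnorm x) * ((q - 1) * (p * hnorm y)) = K * (p * (q - 1) * p).
  by rewrite /K; ring.
exact: ler_piMr.
Qed.

End FugledeTheorem.

(** * Positive semidefinite kernels *)

Section Kernels.
Variable R : realType.

Definition qform (X : Type) (K : X -> X -> R) (s : seq (R * X)) : R :=
  \sum_(p <- s) \sum_(q <- s) p.1 * q.1 * K p.2 q.2.

(** Real coefficients are enough because all kernels here are real and symmetric. As lists may
    repeat points, pullbacks along maps that are not injective stay positive. *)
Definition psd (X : Type) (K : X -> X -> R) : Prop :=
  (forall x y, K x y = K y x) /\ forall s, 0 <= qform K s.

Lemma psd_pullback (X Y : Type) (f : X -> Y) (K : Y -> Y -> R) :
  psd K -> psd (fun x y => K (f x) (f y)).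
Proof.
move=> [sK pK]; split=> [x y|s]; first exact: sK.
rewrite (_ : qform _ s = qform K [seq (p.1, f p.2) | p <- s]) //.
by rewrite /qform big_map; apply: eq_bigr => p _; rewrite big_map.
Qed.

Lemma psd_ext (X : Type) (K L : X -> X -> R) :
  (forall x y, K x y = L x y) -> psd K -> psd L.
Proof.
move=> KL [sK pK]; split=> [x y|s]; first by rewrite -!KL.
have := pK s; congr (_ <= _).
by apply: eq_bigr => p _; apply: eq_bigr => q _; rewrite KL.
Qed.

Lemma Re_sum (I : Type) (r : seq I) (P : pred I) (F : I -> R[i]) :
  complex.Re (\sum_(i <- r | P i) F i) = \sum_(i <- r | P i) complex.Re (F i).
Proof. by elim/big_rec2: _ => // i y1 y2 _ <-; rewrite ReD. Qed.

Lemma Im_sum (I : Type) (r : seq I) (P : pred I) (F : I -> R[i]) :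
  complex.Im (\sum_(i <- r | P i) F i) = \sum_(i <- r | P i) complex.Im (F i).
Proof. by elim/big_rec2: _ => // i y1 y2 _ <-; case: (F i) y2 => [a b] []. Qed.

Lemma psd_complex (X : Type) (K : X -> X -> R) (s : seq (R[i] * X)) : psd K ->
  0 <= \sum_(p <- s) \sum_(q <- s) p.1 * q.1^* * (K p.2 q.2)%:C.
Proof.
move=> [sK pK].
pose u (p : R[i] * X) := (complex.Re p.1, p.2).
pose v (p : R[i] * X) := (complex.Im p.1, p.2).
have ReE : complex.Re (\sum_(p <- s) \sum_(q <- s) p.1 * q.1^* * (K p.2 q.2)%:C) =
    qform K (map u s) + qform K (map v s).
  rewrite /qform !big_map Re_sum -big_split /=.
  apply: eq_bigr => p _; rewrite !big_map -big_split /=.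
  rewrite Re_sum; apply: eq_bigr => q _ /=.
  by case: p q => [[a b] x] [[c d] y] /=; ring.
have ImE : complex.Im (\sum_(p <- s) \sum_(q <- s) p.1 * q.1^* * (K p.2 q.2)%:C) =
    \sum_(p <- s) \sum_(q <- s) (complex.Im p.1 * complex.Re q.1 * K p.2 q.2) -
    \sum_(p <- s) \sum_(q <- s) (complex.Re p.1 * complex.Im q.1 * K p.2 q.2).
  rewrite Im_sum -sumrB; apply: eq_bigr => p _.
  rewrite Im_sum -sumrB; apply: eq_bigr => q _.
  by case: p q => [[a b] x] [[c d] y] /=; ring.
rewrite lecE ReE ImE [X in _ - X]exchange_big /= -sumrB.
rewrite big1 ?eqxx ?addr_ge0 // => p _; rewrite -sumrB big1 // => q _.
by rewrite (sK q.2) [complex.Re _ * _]mulrC subrr.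
Qed.

(** * Integrals of polynomials over [0, 1], beta and Dirichlet integrals *)

Definition primitive (p : {poly R}) : {poly R} :=
  \poly_(i < (size p).+1) (p`_i.-1 / i%:R).

(** At i = 0 the quotient is p_0 / 0 = 0 by convention, so the primitive vanishes at 0. *)
Lemma coef_primitive p i : (primitive p)`_i = p`_i.-1 / i%:R.
Proof.
rewrite coef_poly; case: ltnP => // le; rewrite nth_default ?mul0r //.
by case: i le => //= i; rewrite ltnS.
Qed.

Lemma deriv_primitive p : (primitive p)^`() = p.
Proof.
apply/polyP => i; rewrite coef_deriv coef_primitive /= -[LHS]mulr_natr divfK //.
by rewrite pnatr_eq0.
Qed.

Definition integ01 (p : {poly R}) : R := (primitive p).[1].

Lemma integ01D p q : integ01 (p + q) = integ01 p + integ01 q.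
Proof.
rewrite /integ01 -hornerD; congr (_.[1]); apply/polyP => i.
by rewrite coefD !coef_primitive coefD mulrDl.
Qed.

Lemma integ01Z c p : integ01 (c *: p) = c * integ01 p.
Proof.
rewrite /integ01 -hornerZ; congr (_.[1]); apply/polyP => i.
by rewrite coefZ !coef_primitive coefZ mulrA.
Qed.

Lemma integ010 : integ01 0 = 0.
Proof. by rewrite -(scale0r 0) integ01Z mul0r. Qed.

Lemma integ01_deriv p : integ01 p^`() = p.[1] - p.[0].
Proof.
rewrite -[p.[0]](hornerC _ 1) -hornerN -hornerD /integ01; congr (_.[1]).
apply/polyP => i; rewrite coef_primitive coefD coefN coefC coef_deriv horner_coef0.
case: i => [|i] /=; first by rewrite invr0 mulr0 subrr.
by rewrite subr0 -[_ *+ _]mulr_natr mulfK // pnatr_eq0.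
Qed.

(** By the mean value theorem the integral is a value of p at an interior point. *)
Lemma integ01_ge0 p : (forall x, 0 < x < 1 -> 0 <= p.[x]) -> 0 <= integ01 p.
Proof.
move=> p0; rewrite /integ01.
have p00 : (primitive p).[0] = 0 by rewrite horner_coef0 coef_primitive invr0 mulr0.
have [c c01] := poly_mvt (primitive p) (@ltr01 R).
rewrite p00 !subr0 mulr1 deriv_primitive => ->; apply: p0.
by rewrite !(itvP c01).
Qed.

(** Euler's beta function at (x + 1, y + 1). *)
Definition beta (x y : nat) : R := (x`! * y`!)%:R / ((x + y).+1)`!%:R.

(** Integration by parts: X^(x+1) (1 - X)^(y+1) vanishes at both ends, so its derivative has
    integral 0 and lowers y by one. *)
Lemma integ01_beta x y : integ01 ('X^x * (1 - 'X) ^+ y) = beta x y.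
Proof.
elim: y x => [|y IH] x.
  have := integ01_deriv 'X^(x.+1); rewrite derivXn -scaler_nat integ01Z /=.
  rewrite !hornerXn expr1n expr0n subr0 expr0 mulr1 /beta muln1 addn0 factS natrM.
  move=> E; have f0 : x`!%:R != 0 :> R by rewrite pnatr_eq0 -lt0n fact_gt0.
  have x0 : x.+1%:R != 0 :> R by rewrite pnatr_eq0.
  by apply: (mulfI x0); rewrite E; field; rewrite ?nat1r ?natr1 ?f0 ?x0.
have := integ01_deriv ('X^(x.+1) * (1 - 'X) ^+ y.+1).
have -> : ('X^(x.+1) * (1 - 'X) ^+ y.+1)^`() =
    x.+1%:R *: ('X^x * (1 - 'X) ^+ y.+1) + (- y.+1%:R) *: ('X^(x.+1) * (1 - 'X) ^+ y) :> {poly R}.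
  rewrite derivM derivXn deriv_exp derivB derivX derivC /=.
  by rewrite -!mul_polyC polyCN !polyC_natr; ring.
rewrite integ01D !integ01Z IH !hornerM !hornerXn !horner_exp !hornerE subrr expr0n /= mulr0.
rewrite expr0n /= mul0r subrr !mulNr => /eqP; rewrite subr_eq0 => /eqP E.
have x0 : x.+1%:R != 0 :> R by rewrite pnatr_eq0.
apply: (mulfI x0); rewrite E /beta; have -> : ((x.+1 + y).+1 = (x + y.+1).+1)%N by lia.
by rewrite !mulrA -!natrM !factS; congr (_%:R / _); ring.
Qed.

(* The beta function is an integral of monomials, so for each point of integration its factors
   can be absorbed in the coefficients of the quadratic form. *)
Lemma psd_beta (X : Type) (K : X -> X -> R) (a c : nat) (s t : X -> nat) : psd K ->
  psd (fun x y => K x y * beta (a + (s x + s y)) (c + (t x + t y))).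
Proof.
move=> [sK pK]; split=> [x y|l]; first by rewrite sK (addnC (s x)) (addnC (t x)).
pose P : {poly R} := \sum_(p <- l) \sum_(q <- l) (p.1 * q.1 * K p.2 q.2) *:
  ('X^(a + (s p.2 + s q.2)) * (1 - 'X) ^+ (c + (t p.2 + t q.2))).
have -> : qform (fun x y => K x y * beta (a + (s x + s y)) (c + (t x + t y))) l = integ01 P.
  rewrite /P (big_morph _ integ01D integ010); apply: eq_bigr => p _.
  rewrite (big_morph _ integ01D integ010); apply: eq_bigr => q _.
  by rewrite integ01Z integ01_beta mulrA.
apply: integ01_ge0 => x /andP[x0 x1].
have x2 : 0 <= 1 - x by rewrite subr_ge0 ltW.
pose g (p : R * X) := (p.1 * (x ^+ s p.2 * (1 - x) ^+ t p.2), p.2).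
have -> : P.[x] = x ^+ a * (1 - x) ^+ c * qform K (map g l).
  rewrite /P horner_sum /qform big_map mulr_sumr; apply: eq_bigr => p _.
  rewrite horner_sum big_map mulr_sumr; apply: eq_bigr => q _.
  rewrite hornerZ hornerM hornerXn horner_exp !hornerE /g /= !exprD; ring.
by rewrite mulr_ge0 ?pK // mulr_ge0 // exprn_ge0 // ltW.
Qed.

Definition dirichlet (k : nat) (n : 'I_k.+1 -> nat) : R :=
  (\prod_(i < k.+1) (n i)`!)%:R / ((k + \sum_(i < k.+1) n i)`!)%:R.

(** In the integral over the simplex, fix the first coordinate t and rescale the others by 1 - t: a
    simplex of one dimension less remains, and k in the second argument of [beta] comes from the
    Jacobian. *)
Lemma dirichlet_recl k (n : 'I_k.+2 -> nat) :
  dirichlet n = beta (n ord0) (k + \sum_(i < k.+1) n (lift ord0 i)) *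
    dirichlet (fun i => n (lift ord0 i)).
Proof.
rewrite /dirichlet /beta !(big_ord_recl k.+1); cbv beta.
set p := (\prod_(i < k.+1) _)%N; set S := (\sum_(i < k.+1) _)%N.
have -> : (n ord0 + (k + S)).+1 = (k.+1 + (n ord0 + S))%N by lia.
have f0 j : j`!%:R != 0 :> R by rewrite pnatr_eq0 -lt0n fact_gt0.
rewrite [((n ord0)`! * p)%:R]natrM [(_ * (k + S)`!)%:R]natrM.
move: (f0 (k + S)%N) (f0 (k.+1 + (n ord0 + S))%N).
move: ((k + S)`!%:R : R) ((k.+1 + (n ord0 + S))`!%:R : R) => d e d0 e0; by field; rewrite d0 e0.
Qed.

(** The exponents must split as s x + s y up to a constant w for [psd_beta] to absorb them.
    Multi-indices n + p do not split so in general; they do on the blocks of [psd_model]. *)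
Lemma psd_dirichlet (X : Type) (K : X -> X -> R) k (w : 'I_k.+1 -> nat)
    (s : X -> 'I_k.+1 -> nat) : psd K ->
  psd (fun x y => K x y * dirichlet (fun i => w i + (s x i + s y i))%N).
Proof.
elim: k w s => [|k IH] w s pK.
  apply: psd_ext pK => x y; rewrite /dirichlet !big_ord1 add0n divff ?mulr1 //.
  by rewrite pnatr_eq0 -lt0n fact_gt0.
have := psd_beta (w ord0) (k + \sum_(i < k.+1) w (lift ord0 i)) (fun x => s x ord0)
  (fun x => \sum_(i < k.+1) s x (lift ord0 i))%N
  (IH (fun i => w (lift ord0 i)) (fun x i => s x (lift ord0 i)) pK).
apply: psd_ext => x y; rewrite dirichlet_recl -mulrA; congr (_ * _).
by rewrite mulrC; congr (beta _ _ * _); rewrite -addnA !big_split.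
Qed.

Lemma eq_big_all (T : Type) (P : pred T) (F G : T -> R) (s : seq T) : all P s ->
  (forall x, P x -> F x = G x) -> \sum_(x <- s) F x = \sum_(x <- s) G x.
Proof.
move=> + FG; elim: s => [|x s IH] /=; first by rewrite !big_nil.
by move=> /andP[Px /IH E]; rewrite !big_cons FG ?E.
Qed.

(** The form is a sum over the classes c that occur; [g c] keeps every point and puts coefficient 0
    on those outside c. *)
Lemma psd_blocks (X : Type) (C : eqType) (cls : X -> C) (K : C -> X -> X -> R) :
  (forall c, psd (K c)) ->
  psd (fun x y => (cls x == cls y)%:R * K (cls x) x y).
Proof.
move=> pK; split=> [x y|s].
  by rewrite eq_sym; have [->|] := eqVneq; rewrite ?mul0r // (proj1 (pK _)).
pose g c (p : R * X) := (p.1 * (cls p.2 == c)%:R, p.2).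
rewrite (_ : qform _ s = \sum_(c <- undup [seq cls p.2 | p <- s]) qform (K c) (map (g c) s)).
  by apply: sumr_ge0 => c _; apply: (proj2 (pK c)).
rewrite /qform; under [RHS]eq_bigr => c _ do rewrite big_map.
rewrite [RHS]exchange_big /=; set U := undup _.
have : all (fun p => cls p.2 \in U) s.
  by rewrite -(all_map (fun p => cls p.2) (mem U)); apply/allP => c; rewrite /U inE mem_undup.
move/eq_big_all; apply => p cp.
under [RHS]eq_bigr => c _ do rewrite big_map.
rewrite [RHS]exchange_big /=; apply: eq_bigr => q _.
rewrite (bigD1_seq (cls p.2)) ?undup_uniq //= eqxx mulr1 big1 ?addr0.
  by rewrite (eq_sym (cls q.2)); case: (_ == _); rewrite ?mulr1 ?mul1r // mul0r !mulr0 mul0r.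
by move=> c; rewrite eq_sym => /negbTE ->; rewrite mulr0 !mul0r.
Qed.

End Kernels.

(** * Realization of kernels in a Hilbert space *)

Section Realization.
Variables (R : realType) (H : hilbert R).

(** A discriminant argument along the line t = - l phi with l real. *)
Lemma quad_form_cs (A D : R) (phi : R[i]) : 0 <= D ->
  (forall t : R[i], 0 <= A + 2 * complex.Re (t^* * phi) + cmod t ^+ 2 * D) ->
  cmod phi ^+ 2 <= D * A.
Proof.
move=> D0 pos.
have pos' (l : R) : 0 <= A - 2 * l * cmod phi ^+ 2 + l ^+ 2 * cmod phi ^+ 2 * D.
  have := pos (- (l%:C * phi)).
  have -> : (- (l%:C * phi))^* * phi = l%:C * - (phi * phi^*).
    by rewrite conjN conjM conj_RC; ring.
  rewrite ReRC ReN mul_conj cmodN cmodM cmod_real exprMn real_normK ?num_real //=.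
  by rewrite !mulrN mulrA.
have [D1|] := eqVneq D 0.
  rewrite D1 mul0r leNgt; apply/negP => c0.
  (* With D = 0 this value of l makes the expression equal to -1. *)
  have := pos' ((A + 1) / (2 * cmod phi ^+ 2)); rewrite D1 mulr0 addr0.
  move: (cmod phi) c0 => c c0.
  have -> : 2 * ((A + 1) / (2 * c ^+ 2)) * c ^+ 2 = A + 1.
    by field; apply: contraTneq c0 => ->; rewrite expr0n ltxx.
  lra.
move=> Dn; have Dp : 0 < D by rewrite lt0r Dn.
have := pos' D^-1.
have -> : A - 2 * D^-1 * cmod phi ^+ 2 + D^-1 ^+ 2 * cmod phi ^+ 2 * D = A - cmod phi ^+ 2 / D.
  by field.
by rewrite subr_ge0 ler_pdivrMr // mulrC.
Qed.

Lemma comb_gram (X Y : Type) (v : X -> H) (w : Y -> H) (s : seq (R[i] * X))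
    (t : seq (R[i] * Y)) :
  '[comb v s, comb w t] = \sum_(p <- s) \sum_(q <- t) p.1 * q.1^* * '[v p.2, w q.2].
Proof.
rewrite inner_suml; apply: eq_bigr => p _; rewrite inner_sumr; apply: eq_bigr => q _.
by rewrite innerZl innerZr mulrA.
Qed.

Variable e : nat -> H.
Hypothesis e_orthonormal : forall i j, '[e i, e j] = (i == j)%:R.

(** The second clause keeps the later e_k orthogonal to all vectors so far, so each step finds a
    fresh direction. *)
Definition partial_realization (K : nat -> nat -> R) (l : seq H) : Prop :=
  (forall i j, (i < size l)%N -> (j < size l)%N -> '[l`_i, l`_j] = (K i j)%:C) /\
  (forall i k, (i < size l)%N -> (size l <= k)%N -> '[l`_i, e k] = 0).

(* One Cholesky step: the new vector is the projection dictated by the kernel plus a multiple of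
   a fresh basis vector. *)
Lemma realization_step (K : nat -> nat -> R) l : psd K -> partial_realization K l ->
  exists z, partial_realization K (rcons l z).
Proof.
move=> pK [gram perp]; pose n := size l; pose D := K n n.
have [sK _] := pK.
have D0 : 0 <= D.
  by have := proj2 pK [:: (1, n)]; rewrite /qform !big_seq1 !mul1r.
pose v (i : 'I_n) := l`_i.
pose g (i : 'I_n) : R[i]^o := (K i n)%:C.
(* Positivity of K on s plus t times the new point, for all t, says that the prescribed inner
   products form a functional of norm at most sqrt D. *)
have bound s : cmod (comb g s) <= Num.sqrt D * hnorm (comb v s).
  rewrite -(ler_pXn2r (ltn0Sn 1)) ?nnegrE ?cmod_ge0 ?mulr_ge0 ?hnorm_ge0 ?sqrtr_ge0 //.
  rewrite exprMn sqr_sqrtr //; apply: quad_form_cs => // t.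
  pose s' := [seq (p.1, val p.2) | p <- s].
  have := psd_complex (s' ++ [:: (t, n)]) pK.
  have -> : \sum_(p <- s' ++ [:: (t, n)]) \sum_(q <- s' ++ [:: (t, n)])
        p.1 * q.1^* * (K p.2 q.2)%:C =
      '[comb v s, comb v s] + (t^* * comb g s + (t^* * comb g s)^*) + t * t^* * D%:C.
    rewrite big_cat big_seq1 /= big_cat big_seq1 /= -/D.
    under eq_bigr => p _ do rewrite big_cat big_seq1 /=.
    rewrite big_split /= comb_gram /s' !big_map /=.
    under [X in X + _ + _ = _]eq_bigr => p _ do rewrite big_map /=.
    have E1 : \sum_(p <- s) p.1 * t^* * (K (val p.2) n)%:C = t^* * comb g s.
      rewrite /comb mulr_sumr; apply: eq_bigr => p _; rewrite scaleCE /g; ring.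
    have E2 : \sum_(p <- s) t * p.1^* * (K n (val p.2))%:C = (t^* * comb g s)^*.
      rewrite -E1 rmorph_sum /=; apply: eq_bigr => p _.
      by rewrite !conjM conjK conj_RC sK; ring.
    rewrite E1 E2 !addrA; congr (_ + _ + _ + _).
    apply: eq_bigr => p _; apply: eq_bigr => q _; rewrite gram //; exact: ltn_ord.
  move/ge0_Re; rewrite !ReD Re_conj mul_conj inner_hnorm.
  by rewrite [X in _ + X]ReRC /= mulrDl mul1r.
have [z [vz perpz zle _]] := riesz (sqrtr_ge0 D) bound.
have zD : hnorm z ^+ 2 <= D.
  by rewrite -(sqr_sqrtr D0) ler_pXn2r ?nnegrE ?hnorm_ge0 ?sqrtr_ge0.
have ze k : (n <= k)%N -> '[z, e k] = 0.
  by move=> le; apply: perpz => i; apply: perp.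
pose c := Num.sqrt (D - hnorm z ^+ 2).
have cc : c%:C * c%:C = D%:C - (hnorm z ^+ 2)%:C.
  by rewrite -rmorphB /= -rmorphM /= -expr2 sqr_sqrtr // subr_ge0.
pose y := z + c%:C *: e n; exists y.
have lz i : (i < n)%N -> '[l`_i, y] = (K i n)%:C.
  move=> lt; rewrite innerDr innerZr perp // mulr0 addr0.
  exact: (vz (Ordinal lt)).
split=> i j; rewrite size_rcons !ltnS.
  rewrite !nth_rcons -/n.
  case: ltngtP => // [lti|->] _; case: ltngtP => // [ltj|->] _.
  - exact: gram.
  - exact: lz.
  - by rewrite innerC lz // conj_RC sK.
  rewrite {1}/y innerDl innerZl !innerDr !innerZr conj_RC e_orthonormal eqxx mulr1.
  by rewrite inner_hnorm (innerC z (e n)) ze // conjC0 !mulr0 addr0 add0r cc addrC subrK.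
rewrite nth_rcons -/n leq_eqVlt => /orP[/eqP ->|lti] lt.
  by rewrite ltnn eqxx /y innerDl innerZl ze ?(ltnW lt) // e_orthonormal ltn_eqF // mulr0 addr0.
by rewrite lti; apply: perp => //; apply: ltnW.
Qed.

Lemma realization_nat (K : nat -> nat -> R) : psd K ->
  exists v : nat -> H, forall i j, '[v i, v j] = (K i j)%:C.
Proof.
move=> pK.
have [f hf] : exists f : seq H -> H, forall l, partial_realization K l ->
    partial_realization K (rcons l (f l)).
  apply: (@fun_choice _ _ (fun l z =>
    partial_realization K l -> partial_realization K (rcons l z))) => l.
  case: (excluded_middle_informative (partial_realization K l)).
    by move=> /(realization_step pK) [z hz]; exists z.
  by move=> np; exists 0.
pose L n := iter n (fun l => rcons l (f l)) [::].
have sL n : size (L n) = n by elim: n => //= n IH; rewrite size_rcons IH.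
have pL n : partial_realization K (L n) by elim: n => [|n IH]; [split | apply: hf].
have nL n k i : (i < n)%N -> (L (n + k)%N)`_i = (L n)`_i.
  move=> lt; elim: k => [|k IH]; first by rewrite addn0.
  by rewrite addnS /= nth_rcons sL (leq_trans lt (leq_addr _ _)).
exists (fun i => (L i.+1)`_i) => i j.
rewrite -(nL i.+1 j i) // -(nL j.+1 i j) // (_ : j.+1 + i = i.+1 + j)%N; last by lia.
apply: (proj1 (pL _)); rewrite sL; lia.
Qed.

Lemma realization (X : countType) (x0 : X) (K : X -> X -> R) : psd K ->
  exists v : X -> H, forall x y, '[v x, v y] = (K x y)%:C.
Proof.
move=> pK; pose g n := odflt x0 (unpickle n).
have [v hv] := realization_nat (psd_pullback g pK).
exists (fun x => v (pickle x)) => x y.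
by rewrite hv /g !pickleK.
Qed.

End Realization.

(** * Shifts on the realization of a kernel *)

(** Logarithmic convexity makes the successive ratios nondecreasing: a first ratio rho > M would
    persist, and by Bernoulli's inequality (rho / M)^l outgrows every C. *)
Lemma logconvex_growth (R : realType) (a : nat -> R) (C M : R) : 0 < M ->
  (forall l, 0 <= a l) -> (forall l, a l.+1 ^+ 2 <= a l * a l.+2) ->
  (forall l, a l <= C * M ^+ l) -> a 1%N <= M * a 0%N.
Proof.
move=> M0 a0 lc gr; rewrite leNgt; apply/negP => lt.
have a00 : 0 < a 0%N.
  rewrite lt0r a0 andbT; apply/eqP => E; have := lc 0%N; move: lt; rewrite E mulr0 mul0r.
  by move=> p; rewrite leNgt exprn_gt0.
pose rho := a 1%N / a 0%N.
have rhoM : M < rho by rewrite ltr_pdivlMr.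
have rho0 : 0 < rho by apply: lt_trans rhoM.
have step l : 0 < a l /\ rho * a l <= a l.+1.
  elim: l => [|l [p le]]; first by rewrite /rho divfK ?gt_eqF.
  have p' : 0 < a l.+1 by apply: lt_le_trans le; rewrite mulr_gt0.
  split=> //; rewrite -(ler_pM2l p); apply: le_trans (lc l).
  by rewrite mulrCA mulrA expr2 ler_pM2r.
have low l : rho ^+ l * a 0%N <= a l.
  elim: l => [|l IH]; first by rewrite mul1r.
  by apply: le_trans (proj2 (step l)); rewrite exprS -mulrA ler_pM2l.
pose h := rho / M - 1.
have h0 : 0 < h by rewrite subr_gt0 ltr_pdivlMr // mul1r.
have bern l : 1 + l%:R * h <= (1 + h) ^+ l.
  elim: l => [|l IH]; first by rewrite mul0r addr0.
  rewrite exprS; have hl : 0 <= l%:R * h * h by rewrite !mulr_ge0 // ltW.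
  have : (1 + h) * (1 + l%:R * h) <= (1 + h) * (1 + h) ^+ l by rewrite ler_pM2l //; lra.
  by apply: le_trans; rewrite -natr1; move: hl; nra.
have up l : (1 + l%:R * h) * a 0%N <= C.
  apply: (@le_trans _ _ ((1 + h) ^+ l * a 0%N)); first by rewrite ler_pM2r.
  rewrite -(ler_pM2r (exprn_gt0 l M0)); apply: le_trans (gr l); apply: le_trans (low l).
  by rewrite mulrAC -exprMn /h addrC subrK divfK ?gt_eqF.
have C0 : 0 <= C by have := up 0%N; rewrite mul0r addr0 mul1r; apply: le_trans; apply: a0.
have k0 : 0 <= C / (h * a 0%N) by rewrite divr_ge0 // ltW // mulr_gt0.
have := up (Num.bound (C / (h * a 0%N))).
have := archi_boundP k0; rewrite ltr_pdivrMr ?mulr_gt0 //.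
by move: (Num.bound _)%:R => N; nra.
Qed.

Section KernelShifts.
Variables (R : realType) (H : hilbert R) (X : Type).
Variables (v : X -> H) (K : X -> X -> R).
Hypothesis gramK : forall x y, '[v x, v y] = (K x y)%:C.

(* With tau' the formal adjoint of the shift v x |-> v (tau x), the numbers <(tau' tau)^l u, u> are
   logarithmically convex in l, so their first ratio is at most their exponential growth rate. *)
Lemma shift_bound (tau tau' : X -> X) (M : R) : 0 < M ->
  (forall x y, K (tau x) y = K x (tau' y)) ->
  (forall x, tau (tau' x) = tau' (tau x)) ->
  (forall x y, exists C, forall l, `|K (iter l (tau' \o tau) x) y| <= C * M ^+ l) ->
  forall s, hnorm (comb (v \o tau) s) <= Num.sqrt M * hnorm (comb v s).
Proof.
move=> M0 adjK tauC gr s; pose sg := tau' \o tau.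
have symK x y : K x y = K y x.
  by apply: complexI; rewrite -!gramK innerC gramK conj_RC.
have adjK' x y : K (tau' x) y = K x (tau y) by rewrite symK -adjK symK.
have sgK x y : K (sg x) y = K x (sg y) by rewrite /sg /= adjK' adjK.
have itK l x y : K (iter l sg x) y = K x (iter l sg y).
  by elim: l x => [|l IH] x //; rewrite iterSr IH sgK.
have tsg l x : tau (iter l sg x) = iter l sg (tau x).
  by elim: l => //= l IH; rewrite tauC IH.
(* The power sg^l can be shared between the two slots; for odd l the remaining tau' tau leaves one
   tau in each. Hence [al] is always a squared norm. *)
pose al l := '[comb (v \o iter l sg) s, comb v s].
have al0 j k : '[comb (v \o iter j sg) s, comb (v \o iter k sg) s] = al (j + k)%N.
  rewrite /al !comb_gram; apply: eq_bigr => p _; apply: eq_bigr => q _; congr (_ * _).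
  by rewrite /= !gramK -itK -iterD addnC.
have al1 j k : '[comb (v \o tau \o iter j sg) s, comb (v \o tau \o iter k sg) s] = al (j + k).+1.
  rewrite /al !comb_gram; apply: eq_bigr => p _; apply: eq_bigr => q _; congr (_ * _).
  by rewrite /= !gramK adjK -[tau' _]/(iter k.+1 sg q.2) -itK -iterD addSn addnC.
pose a l := complex.Re (al l).
have alE l : 0 <= al l.
  rewrite -(odd_double_half l) -addnn; case: (odd l); rewrite /= ?add0n ?add1n.
    by rewrite -al1 hinner_ge0.
  by rewrite -al0 hinner_ge0.
have csq (x y : H) (b c d : R[i]) : '[x, x] = b -> '[x, y] = c -> '[y, y] = d -> 0 <= c ->
    complex.Re c ^+ 2 <= complex.Re b * complex.Re d.
  move=> <- <- <- c0; rewrite -!hnorm_sqr -exprMn ler_pXn2r ?nnegrE ?mulr_ge0 ?hnorm_ge0 ?ge0_Re //.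
  exact: le_trans (Re_le_cmod _) (cauchy_schwarz _ _).
have lc l : a l.+1 ^+ 2 <= a l * a l.+2.
  rewrite /a -(odd_double_half l) -addnn; set h := l./2; case: (odd l); rewrite /= ?add0n ?add1n.
    have e2 := al1 h h.+1; have e3 := al1 h.+1 h.+1; rewrite addSn !addnS in e2 e3.
    exact: csq (al1 h h) e2 e3 (alE _).
  have e2 := al0 h h.+1; have e3 := al0 h.+1 h.+1; rewrite addSn !addnS in e2 e3.
  exact: csq (al0 h h) e2 e3 (alE _).
have [C hC] : exists C, forall l, a l <= C * M ^+ l.
  rewrite /a /al; suff [C hC] : exists C, forall l,
      cmod '[comb (v \o iter l sg) s, comb v s] <= C * M ^+ l.
    by exists C => l; apply: le_trans (Re_le_cmod _) _.
  have grs t x : exists C, forall l, cmod '[v (iter l sg x), comb v t] <= C * M ^+ l.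
    elim: t => [|[c y] t [C hC]].
      by exists 0 => l; rewrite /comb big_nil inner0r cmod0 mul0r.
    have [C' hC'] := gr x y; exists (cmod c * C' + C) => l.
    rewrite /comb big_cons -/(comb v t) innerDr innerZr gramK mulrDl.
    apply: le_trans (cmodD _ _) _; rewrite lerD // cmodM cmodJ cmod_real -mulrA.
    by rewrite ler_wpM2l ?cmod_ge0 //; apply: hC'.
  have : forall t, exists C, forall l, cmod '[comb (v \o iter l sg) t, comb v s] <= C * M ^+ l.
    elim=> [|[c x] t [C hC]].
      by exists 0 => l; rewrite /comb big_nil inner0l cmod0 mul0r.
    have [C' hC'] := grs s x; exists (cmod c * C' + C) => l.
    rewrite /comb big_cons -/(comb _ t) innerDl innerZl mulrDl.
    apply: le_trans (cmodD _ _) _; rewrite lerD ?hC // cmodM -mulrA.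
    by rewrite ler_wpM2l ?cmod_ge0 //; apply: hC'.
  exact.
have := logconvex_growth (a := a) M0 (fun l => ge0_Re (alE l)) lc hC.
rewrite {1 2}/a -(al1 0%N 0%N) -(al0 0%N 0%N) -!hnorm_sqr /= => le.
rewrite -(ler_pXn2r (ltn0Sn 1)) ?nnegrE ?mulr_ge0 ?hnorm_ge0 ?sqrtr_ge0 //.
by rewrite exprMn [X in _ <= X * _]sqr_sqrtr ?(ltW M0).
Qed.

(** B is the adjoint of the shift along tau, so on the family v it acts as the shift along the
    formal adjoint of tau ([shift_apply]). The last clause puts its range in the closed span of v;
    thus B is determined, vanishes on the orthogonal complement, and identities can be tested
    against v. *)
Definition is_shift (tau : X -> X) (B : H -> H) : Prop :=
  [/\ bounded_op B, forall x y, '[v x, B y] = '[v (tau x), y] &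
    forall y z, (forall x, '[v x, z] = 0) -> '[B y, z] = 0].

Lemma shift_exists (tau tau' : X -> X) (M : R) : 0 < M ->
  (forall x y, K (tau x) y = K x (tau' y)) ->
  (forall x, tau (tau' x) = tau' (tau x)) ->
  (forall x y, exists C, forall l, `|K (iter l (tau' \o tau) x) y| <= C * M ^+ l) ->
  exists B, is_shift tau B.
Proof.
move=> M0 adjK tauC gr.
exact: (bounded_transport (sqrtr_ge0 M) (shift_bound M0 adjK tauC gr)).
Qed.

Lemma span_ext a b : (forall z, (forall x, '[v x, z] = 0) -> '[a, z] = 0) ->
  (forall z, (forall x, '[v x, z] = 0) -> '[b, z] = 0) ->
  (forall x, '[v x, a] = '[v x, b]) -> a = b.
Proof.
move=> ha hb E; apply/eqP; rewrite -subr_eq0; apply/eqP/hinner_eq0.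
have vd x : '[v x, a - b] = 0 by rewrite innerBr E subrr.
by rewrite innerBl ha // hb // subrr.
Qed.

Lemma shift_apply tau tau' B x : (forall x y, K (tau x) y = K x (tau' y)) ->
  is_shift tau B -> B (v x) = v (tau' x).
Proof.
move=> adjK [_ h1 h2]; apply: span_ext; first exact: h2.
  by move=> z; apply.
by move=> y; rewrite h1 !gramK adjK.
Qed.

Lemma shift_comm tau sg A B x : (forall x, tau (sg x) = sg (tau x)) ->
  is_shift tau A -> is_shift sg B -> A (B x) = B (A x).
Proof.
move=> tsC [_ a1 a2] [_ b1 b2]; apply: span_ext; [exact: a2 | exact: b2 |].
by move=> y; rewrite a1 !b1 a1 tsC.
Qed.

Lemma shift_adjoint tau tau' A B : (forall x y, K (tau x) y = K x (tau' y)) ->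
  is_shift tau A -> is_shift tau' B -> is_adjoint A B.
Proof.
move=> adjK sA sB u y; have [bA a1 a2] := sA; have [bB b1 b2] := sB.
have symK x z : K x z = K z x by apply: complexI; rewrite -!gramK innerC gramK conj_RC.
have adjK' x z : K (tau' x) z = K x (tau z) by rewrite symK -adjK symK.
have BA := adjP bB.
(* The difference d is orthogonal to all v x, so B kills it; then d is orthogonal to adj B u and, by
   the range clause, to A u. *)
have d0 x : '[v x, adj B u - A u] = 0.
  by rewrite innerBr -BA a1 (shift_apply _ adjK' sB) subrr.
have Bd : B (adj B u - A u) = 0.
  apply: span_ext => [z|z _|x]; [exact: b2 | exact: inner0l |].
  by rewrite b1 d0 inner0r.
have -> : A u = adj B u.
  apply/esym/eqP; rewrite -subr_eq0; apply/eqP/hinner_eq0.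
  by rewrite innerBr -BA Bd inner0l innerC a2 // conjC0 subr0.
by rewrite innerC -BA -innerC.
Qed.

End KernelShifts.

(** * The shift model *)

Section MultiIndex.
Variable m : nat.
Implicit Types (n p q : mindex m) (i j : 'I_m).

Definition madd n p : mindex m := [ffun i => (n i + p i)%N].

Lemma mabs_shift n j : mabs (mshift n j) = (mabs n).+1.
Proof.
rewrite /mabs (eq_bigr (fun i => n i + (i == j))%N) => [|i _]; last by rewrite ffunE.
rewrite big_split /= -[RHS]addn1; congr (_ + _)%N.
by rewrite (bigD1 j) //= eqxx big1 ?addn0 // => i /negbTE ->.
Qed.

Lemma mabs_add n p : mabs (madd n p) = (mabs n + mabs p)%N.
Proof. by rewrite /mabs -big_split; apply: eq_bigr => i _; rewrite ffunE. Qed.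

Lemma mabs0 : mabs (mzero m) = 0%N.
Proof. by rewrite /mabs big1 // => i _; rewrite ffunE. Qed.

Lemma mshiftC n i j : mshift (mshift n i) j = mshift (mshift n j) i.
Proof. by apply/ffunP => k; rewrite !ffunE addnAC. Qed.

Lemma mshift_inj i : injective (fun n => mshift n i).
Proof. by move=> n p /ffunP E; apply/ffunP => k; have := E k; rewrite !ffunE => /addIn. Qed.

Lemma mshift_addl n p i : madd (mshift n i) p = mshift (madd n p) i.
Proof. by apply/ffunP => k; rewrite !ffunE addnAC. Qed.

Lemma mshift_addr n p i : madd n (mshift p i) = mshift (madd n p) i.
Proof. by apply/ffunP => k; rewrite !ffunE addnA. Qed.

Lemma madd0 n : madd n (mzero m) = n.
Proof. by apply/ffunP => k; rewrite !ffunE addn0. Qed.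

Lemma mindex_pred n : n <> mzero m -> exists j p, n = mshift p j.
Proof.
move=> n0; have [j nj] : exists j, n j != 0%N.
  apply/existsP; apply: contra_notT n0 => /existsPn E; apply/ffunP => j.
  by rewrite ffunE; apply/eqP/negPn/E.
exists j, [ffun i => n i - (i == j)]%N; apply/ffunP => i; rewrite !ffunE.
by case: eqVneq => [->|_]; rewrite ?subnK ?lt0n // subn0 addn0.
Qed.

Definition msingle (i : 'I_m) (l : nat) : mindex m := [ffun j => (j == i) * l]%N.

Lemma mabs_single i l : mabs (msingle i l) = l.
Proof.
rewrite /mabs (bigD1 i) //= ffunE eqxx mul1n big1 ?addn0 // => j ji.
by rewrite ffunE (negbTE ji).
Qed.

End MultiIndex.

Section Dirichlet.
Variables (R : realType) (k : nat).
Implicit Types n : mindex k.+1.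

Lemma dirichlet_gt0 n : 0 < dirichlet R n.
Proof.
rewrite divr_gt0 ?ltr0n ?fact_gt0 //.
by apply: prodn_gt0 => i; apply: fact_gt0.
Qed.

Lemma dirichlet_shift n j :
  dirichlet R (mshift n j) = dirichlet R n * (n j).+1%:R / (k.+1 + mabs n)%:R.
Proof.
rewrite /dirichlet -/(mabs (mshift n j)) -/(mabs n) mabs_shift addnS factS addSn.
have -> : (\prod_(i < k.+1) (mshift n j i)`! = (n j).+1 * \prod_(i < k.+1) (n i)`!)%N.
  rewrite (bigD1 j) //= [in RHS](bigD1 j) //= ffunE eqxx addn1 factS mulnA; congr (_ * _)%N.
  by apply: eq_bigr => i /negbTE ij; rewrite ffunE ij addn0.
have f0 : ((k + mabs n)`!)%:R != 0 :> R by rewrite pnatr_eq0 -lt0n fact_gt0.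
have g0 : (k + mabs n).+1%:R != 0 :> R by rewrite pnatr_eq0.
rewrite (natrM _ (n j).+1) (natrM _ (k + mabs n).+1).
move: (_`!%:R) ((k + mabs n).+1%:R) f0 g0 => a b f0 g0.
by field; rewrite f0 g0.
Qed.

(** The coordinates of a point of the simplex sum to 1. This is what removes the number of variables
    from the action of Q_T. *)
Lemma dirichlet_sum n : \sum_j dirichlet R (mshift n j) = dirichlet R n.
Proof.
under eq_bigr => j _ do rewrite dirichlet_shift.
rewrite -mulr_suml -mulr_sumr -natr_sum.
have -> : (\sum_(j < k.+1) (n j).+1 = k.+1 + mabs n)%N.
  rewrite (eq_bigr (fun j => 1 + n j)%N) // big_split /= sum_nat_const card_ord muln1 //.
by rewrite mulfK // pnatr_eq0.
Qed.

End Dirichlet.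

Definition model_weight (R : realType) (B : nat -> R) (k : nat) (n : mindex k.+1) : R :=
  B (mabs n) * dirichlet R n.

(** [B] stands for the squares of b; with vectors left unnormalized, the weights carry no square
    roots. *)
Definition shift_model (R : realType) (k : nat) (H : hilbert R) (B : nat -> R)
    (g : mindex k.+1 -> H) (T : 'I_k.+1 -> H -> H) : Prop :=
  [/\ forall l, 0 < B l,
      forall n p, '[g n, g p] = ((n == p)%:R * model_weight B n)%:C,
      total g,
      forall j, bounded_op (T j) &
      forall j n, T j (g n) = g (mshift n j)].

(** * Powers of Q_T, joint isometries and expansions *)

Section Model.
Variables (R : realType) (k : nat) (H : hilbert R) (B : nat -> R).
Variables (g : mindex k.+1 -> H) (T : 'I_k.+1 -> H -> H).
Hypothesis model : shift_model B g T.

Let B_gt0 : forall l, 0 < B l. Proof. by case: model. Qed.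
Let gram : forall n p, '[g n, g p] = ((n == p)%:R * model_weight B n)%:C.
Proof. by case: model. Qed.
Let g_total : total g. Proof. by case: model. Qed.
Let bT : forall j, bounded_op (T j). Proof. by case: model. Qed.
Let Tg : forall j n, T j (g n) = g (mshift n j). Proof. by case: model. Qed.

Local Notation c := (@model_weight R B k).

Lemma model_weight_gt0 n : 0 < c n.
Proof. by rewrite /model_weight mulr_gt0 ?dirichlet_gt0. Qed.

Lemma model_norm n : '[g n, g n] = (c n)%:C.
Proof. by rewrite gram eqxx mul1r. Qed.

Lemma model_weight_sum n : \sum_j c (mshift n j) = B (mabs n).+1 / B (mabs n) * c n.
Proof.
rewrite /model_weight; under eq_bigr => j _ do rewrite mabs_shift.
by rewrite -mulr_sumr dirichlet_sum mulrA divfK ?gt_eqF.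
Qed.

Lemma model_adj j n : adj (T j) (g (mshift n j)) = (c (mshift n j) / c n)%:C *: g n.
Proof.
apply: (total_ext g_total) => p; rewrite -(adjP (bT j)) Tg !gram innerZr conj_RC gram -rmorphM.
congr (_%:C); rewrite (inj_eq (@mshift_inj _ j)).
case: eqVneq => [->|_]; last by rewrite !mul0r mulr0.
by rewrite !mul1r divfK ?gt_eqF ?model_weight_gt0.
Qed.

Lemma QTpow_bounded s : bounded_op (QTpow T s).
Proof.
elim: s => [|s IH]; first exact: bounded_id.
apply: bounded_sum => i.
exact: (bounded_comp (adj_bounded (bT i)) (bounded_comp IH (bT i))).
Qed.

Lemma QTpow_model s n : QTpow T s (g n) = (B (mabs n + s) / B (mabs n))%:C *: g n.
Proof.
elim: s n => [|s IH] n; first by rewrite addn0 divff ?gt_eqF // scale1r.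
rewrite /QTpow iterS -/(QTpow T s) /QT.
under eq_bigr => i _ do
  rewrite Tg IH (linearZ_op (proj1 (adj_bounded (bT i)))) model_adj scalerA mabs_shift -rmorphM.
rewrite -scaler_suml -rmorph_sum -mulr_sumr -mulr_suml model_weight_sum; congr (_%:C *: _).
rewrite mulfK ?gt_eqF ?model_weight_gt0 // mulrA divfK ?gt_eqF //.
by rewrite addnS addSn.
Qed.

Definition alt_sum (b : nat -> R) q l : R :=
  \sum_(s < q.+1) (-1) ^+ s * 'C(q, s)%:R * b (l + s)%N.

Lemma Bq_bounded q : bounded_op (Bq T q).
Proof. by apply: bounded_sum => s; apply/bounded_scale/QTpow_bounded. Qed.

Lemma Bq_model q n : Bq T q (g n) = (alt_sum B q (mabs n) / B (mabs n))%:C *: g n.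
Proof.
rewrite /Bq /alt_sum mulr_suml rmorph_sum scaler_suml; apply: eq_bigr => s _.
rewrite QTpow_model scalerA; congr (_ *: _).
have -> : (-1) ^+ s * 'C(q, s)%:R = ((-1) ^+ s * 'C(q, s)%:R)%:C :> R[i].
  by rewrite rmorphM rmorphXn rmorphN1 rmorph_nat.
by rewrite -rmorphM mulrA.
Qed.

Theorem model_isometry q : joint_q_isometry T q <-> forall l, alt_sum B q l = 0.
Proof.
split=> [iso l|E x].
  have := iso (g (msingle ord0 l)); rewrite Bq_model mabs_single.
  move=> /(congr1 (fun y => '[y, g (msingle ord0 l)])); rewrite innerZl inner0l model_norm.
  rewrite -rmorphM => /complexI /eqP.
  rewrite mulf_eq0 (gt_eqF (model_weight_gt0 _)) orbF mulf_eq0 invr_eq0 (gt_eqF (B_gt0 _)) orbF.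
  by move/eqP.
have [s hs] := total_dense x g_total.
apply: hinner_eq0; apply: (ccvg_uniq (u := fun n => '[Bq T q (comb g (s n)), Bq T q x])).
  apply: ccvg_inner; first exact: (hcvg_image (Bq_bounded q)).
  by move=> eps e0; exists 0%N => p _; rewrite subrr hnorm0.
move=> eps e0; exists 0%N => n _.
rewrite (linear_comb_op (proj1 (Bq_bounded q))) /comb big1 ?inner0l ?subrr ?cmod0 //.
by move=> p _; rewrite /= Bq_model E mul0r scale0r scaler0.
Qed.

Lemma psd_const (X : Type) (d : R) : 0 <= d -> psd (fun _ _ : X => d).
Proof.
move=> d0; split=> // s; rewrite /qform.
under eq_bigr => p _ do rewrite -mulr_suml -mulr_sumr.
by rewrite -!mulr_suml mulr_ge0 // -expr2 sqr_ge0.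
Qed.

Theorem model_expansion q : joint_q_expansion T q <-> forall l, alt_sum B q l <= 0.
Proof.
split=> [ex l|E x].
  have := ex (g (msingle ord0 l)); rewrite Bq_model mabs_single innerZl model_norm -rmorphM.
  by rewrite lecR pmulr_lle0 ?model_weight_gt0 // pmulr_lle0 // invr_gt0.
have [s hs] := total_dense x g_total.
rewrite -oppr_ge0; apply: (ccvg_ge0 (u := fun n => '[- Bq T q (comb g (s n)), comb g (s n)])).
  rewrite -innerNl; apply: ccvg_inner => //.
  have bN : bounded_op (fun x => - Bq T q x).
    have [l [M hM]] := bounded_scale (-1) (Bq_bounded q).
    split; first by move=> a y z; have := l a y z; rewrite !scaleN1r.
    by exists M => y; rewrite -scaleN1r.
  exact: (hcvg_image bN).
move=> n; rewrite innerNl (linear_comb_op (proj1 (Bq_bounded q))) comb_gram.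
pose d (v : mindex k.+1) := - alt_sum B q (mabs v) / B (mabs v) * c v.
(* A diagonal kernel is a block kernel whose classes are single points. *)
have pD : psd (fun x y : mindex k.+1 => (x == y)%:R * d x).
  apply: (@psd_blocks R _ (mindex k.+1 : eqType) id (fun v _ _ => d v)) => v; apply: psd_const.
  by rewrite mulr_ge0 ?(ltW (model_weight_gt0 _)) // divr_ge0 ?oppr_ge0 // ltW.
have := psd_complex (s n) pD; congr (_ <= _).
rewrite -sumrN; apply: eq_bigr => p _; rewrite -sumrN; apply: eq_bigr => r _.
rewrite /= Bq_model innerZl gram -rmorphM -[RHS]mulrN -rmorphN; congr (_ * _%:C).
by rewrite /d; ring.
Qed.

End Model.

(** * Subnormality *)

Section ModelKernel.
Variables (R : realType) (k : nat) (B : nat -> R).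
Local Notation c := (@model_weight R B k).

Definition mmin (p q : mindex k.+1) : mindex k.+1 := [ffun i => minn (p i) (q i)].

(* p x + q y = p y + q x says that p - q takes the same value at x and y; on such a block the
   entries depend only on the sum of the coordinatewise minima of p and q. *)
Lemma psd_model (I : Type) (p q : I -> mindex k.+1) :
  (forall l, psd (fun x y => B (l + (mabs (mmin (p x) (q x)) + mabs (mmin (p y) (q y)))))) ->
  psd (fun x y => (madd (p x) (q y) == madd (p y) (q x))%:R * c (madd (p x) (q y))).
Proof.
move=> pB; pose r x := mmin (p x) (q x).
pose C : eqType := (mindex k.+1 * mindex k.+1)%type.
pose cls x : C := ([ffun i => p x i - q x i], [ffun i => q x i - p x i])%N.
pose w (v : C) : mindex k.+1 := madd v.1 v.2.
pose D (v : C) x y := B (mabs (w v) + (mabs (r x) + mabs (r y))) *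
  dirichlet R (fun i => w v i + (r x i + r y i))%N.
have pD v : psd (D v) by apply: psd_dirichlet; apply: pB.
apply: psd_ext (psd_blocks cls pD) => x y.
have -> : (cls x == cls y) = (madd (p x) (q y) == madd (p y) (q x)).
  apply/eqP/eqP => [[/ffunP E1 /ffunP E2]|/ffunP E].
    by apply/ffunP => i; have := E1 i; have := E2 i; rewrite !ffunE; lia.
  by congr (_, _); apply/ffunP => i; have := E i; rewrite !ffunE; lia.
case: eqP => [/ffunP E|_]; last by rewrite !mul0r.
have -> : madd (p x) (q y) = madd (w (cls x)) (madd (r x) (r y)).
  by apply/ffunP => i; have := E i; rewrite !ffunE /=; lia.
rewrite /D /model_weight !mabs_add; congr (_ * (_ * _)).
rewrite /dirichlet; congr (_%:R / (_ + _)`!%:R).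
  by apply: eq_bigr => i _; rewrite !ffunE.
by apply: eq_bigr => i _; rewrite !ffunE.
Qed.

End ModelKernel.

(** The cases l = 0 and l = 1 are the two Hankel conditions of the Stieltjes moment problem. *)
Definition hankel_psd (R : realType) (B : nat -> R) : Prop :=
  forall l, psd (fun s t : nat => B (l + (s + t))%N).

Section Subnormal.
Variables (R : realType) (k : nat) (H : hilbert R) (B : nat -> R).
Variables (g : mindex k.+1 -> H) (T : 'I_k.+1 -> H -> H).
Hypothesis model : shift_model B g T.
Local Notation c := (@model_weight R B k).

(** Since P commutes with N_i, the N_i of the outermost factor moves inward to V x, where it acts as
    T_i; N_i^* goes to the other slot. This is the recursion that defines Q_T^s(I). *)
Lemma subnormal_power (K : hilbert R) (V : H -> K) (N Ns : 'I_k.+1 -> K -> K) :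
  (forall x y, '[V x, V y] = '[x, y]) -> (forall i, bounded_op (N i)) ->
  (forall i, is_adjoint (N i) (Ns i)) -> (forall i j z, N j (Ns i z) = Ns i (N j z)) ->
  (forall i j z, N i (N j z) = N j (N i z)) -> (forall i x, N i (V x) = V (T i x)) ->
  forall s x y, '[iter s (fun z => \sum_i Ns i (N i z)) (V x), V y] = '[QTpow T s x, y].
Proof.
have [_ _ _ bT _] := model.
move=> isoV bN aN NNs NN NV; set P := fun z => _.
have bNs i := adjoint_bounded (bN i) (aN i).
have PN s j z : iter s P (N j z) = N j (iter s P z).
  elim: s => //= s ->; rewrite /P (linear_sum_op (proj1 (bN j))); apply: eq_bigr => i _.
  by rewrite NNs NN.
elim=> [|s IH] x y; first exact: isoV.
rewrite iterS {1}/P inner_suml /QTpow iterS -/(QTpow T s) /QT inner_suml.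
apply: eq_bigr => i _.
rewrite (adj_sym (aN i)) -PN !NV IH.
by rewrite (adj_sym (adjP (bT i))).
Qed.

Lemma subnormal_hankel : jointly_subnormal T -> hankel_psd B.
Proof.
have [B0 gram _ bT _] := model.
move=> [K [V [N [_ [isoV [nN [NN NV]]]]]]] l.
have bN i : bounded_op (N i) by case: (nN i).
have [Ns hNs] : exists Ns : 'I_k.+1 -> K -> K,
    forall i, is_adjoint (N i) (Ns i) /\ forall x, N i (Ns i x) = Ns i (N i x).
  apply: (@fun_choice _ _ (fun i Ni =>
    is_adjoint (N i) Ni /\ forall x, N i (Ni x) = Ni (N i x))) => i.
  by have [_ [Ni [h1 h2]]] := nN i; exists Ni.
have NNs i j z : N j (Ns i z) = Ns i (N j z).
  by apply: (fuglede (bN i) (bN j) (proj1 (hNs i)) (proj2 (hNs i))) => x.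
have pow := subnormal_power isoV bN (fun i => proj1 (hNs i)) NNs NN NV.
set P := fun z => _ in pow; pose n := msingle (ord0 : 'I_k.+1) l.
have aP : is_adjoint P P.
  move=> x y; rewrite inner_suml inner_sumr; apply: eq_bigr => i _.
  by rewrite (adj_sym (proj1 (hNs i))) (proj1 (hNs i)).
split=> [s t|s]; first by rewrite (addnC s).
pose u := \sum_(p <- s) (p.1)%:C *: iter p.2 P (V (g n)).
have c0 : 0 < c n / B l by rewrite divr_gt0 ?(model_weight_gt0 model).
rewrite -(pmulr_rge0 _ c0) -ler0c; have := hinner_ge0 u; congr (_ <= _).
rewrite /u inner_suml /qform mulr_sumr rmorph_sum; apply: eq_bigr => p _.
rewrite inner_sumr mulr_sumr rmorph_sum; apply: eq_bigr => q _.
rewrite innerZl innerZr conj_RC -(iter_adjoint _ _ _ aP) -iterD pow.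
rewrite (QTpow_model model) innerZl (model_norm model) mabs_single -!rmorphM.
by rewrite (addnC q.2); congr (_%:C); ring.
Qed.

End Subnormal.

Section HankelSubnormal.
Variables (R : realType) (k : nat) (H : hilbert R) (B : nat -> R).
Variables (g : mindex k.+1 -> H) (T : 'I_k.+1 -> H -> H).
Hypothesis model : shift_model B g T.
Local Notation c := (@model_weight R B k).
Local Notation X := (mindex k.+1 * mindex k.+1)%type.

(* Moments of a Halmos-type extension: the pair (p, q) stands for the vector N^p (N^q)^* g_0. *)
Definition moment_kernel (x y : X) : R :=
  (madd x.1 y.2 == madd y.1 x.2)%:R * c (madd x.1 y.2).

(** It supplies the fresh directions of [realization], so that H can host its own extension. *)
Lemma orthonormal_sequence : exists e : nat -> H, forall i j, '[e i, e j] = (i == j)%:R.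
Proof.
have [_ gram _ _ _] := model; pose n i := msingle (ord0 : 'I_k.+1) i.
have nI i j : (n i == n j) = (i == j).
  by apply/eqP/eqP => [E|->//]; rewrite -(mabs_single (ord0 : 'I_k.+1) i) -/(n i) E mabs_single.
exists (fun i => ((Num.sqrt (c (n i)))^-1)%:C *: g (n i)) => i j.
rewrite innerZl innerZr conj_RC gram nI -!rmorphM -(rmorph_nat (real_complex R)); congr (_%:C).
have [->|_] := eqVneq; last by rewrite mul0r !mulr0.
set s := Num.sqrt _; have ss : c (n j) = s * s.
  by rewrite -expr2 sqr_sqrtr // ltW // (model_weight_gt0 model).
have s0 : s != 0 by rewrite gt_eqF // sqrtr_gt0 (model_weight_gt0 model).
by rewrite ss mulr1n mul1r; field.
Qed.

Lemma weight_growth i : exists2 M, 0 < M &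
  forall l n, c (iter l (fun p => mshift p i) n) <= c n * M ^+ l.
Proof.
have [_ _ _ bT Tg] := model.
(* The summand 1 only serves to make the rate positive. *)
have [M0 M0_ge0 hM] := bounded_opP (bT i); exists (M0 ^+ 2 + 1).
  by rewrite ltr_wpDl ?sqr_ge0.
have step n : c (mshift n i) <= c n * (M0 ^+ 2 + 1).
  rewrite -lecR -(model_norm model) -Tg inner_hnorm lecR.
  have : hnorm (T i (g n)) ^+ 2 <= (M0 * hnorm (g n)) ^+ 2.
    by rewrite ler_pXn2r ?nnegrE ?mulr_ge0 ?hnorm_ge0.
  move/le_trans; apply; rewrite exprMn mulrC hnorm_sqr (model_norm model) /=.
  by rewrite ler_pM2l ?(model_weight_gt0 model) // lerDl.
elim=> [|l IH] n; first by rewrite mulr1.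
rewrite iterS; apply: le_trans (step _) _; rewrite [_ ^+ l.+1]exprSr mulrA ler_pM2r //.
by rewrite ltr_wpDl ?sqr_ge0.
Qed.

Theorem hankel_subnormal : hankel_psd B -> jointly_subnormal T.
Proof.
have [B0 gram tg bT Tg] := model; move=> hB.
have pK : psd moment_kernel.
  apply: psd_model => l.
  exact: (psd_pullback (fun x : X => mabs (mmin x.1 x.2)) (hB l)).
have [e eO] := orthonormal_sequence.
have [v gramv] := realization eO ((mzero _, mzero _) : X) pK.
pose up i (x : X) : X := (mshift x.1 i, x.2).
pose dn i (x : X) : X := (x.1, mshift x.2 i).
have adjU i x y : moment_kernel (up i x) y = moment_kernel x (dn i y).
  by rewrite /moment_kernel /= mshift_addl mshift_addr.
have symK x y : moment_kernel x y = moment_kernel y x by case: pK.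
have adjD i x y : moment_kernel (dn i x) y = moment_kernel x (up i y).
  by rewrite symK -adjU symK.
have growth i : exists2 M, 0 < M & forall x y, exists C, forall l,
    `|moment_kernel (iter l (dn i \o up i) x) y| <= C * M ^+ l.
  have [M M0 hM] := weight_growth i; exists M => // x y; exists (c (madd x.1 y.2)) => l.
  have -> : iter l (dn i \o up i) x =
      (iter l (fun p => mshift p i) x.1, iter l (fun p => mshift p i) x.2).
    by elim: l => [|l /= ->] //; case: x.
  have addl p q : madd (iter l (fun p => mshift p i) p) q = iter l (fun p => mshift p i) (madd p q).
    by elim: l => //= l IH; rewrite mshift_addl IH.
  (* Each iteration raises both components, but the weight sees the first one only, so l iterations
     cost M^l; the second enters the indicator, which is at most 1. *)
  rewrite /moment_kernel /= addl normrM ger0_norm ?ler0n // (gtr0_norm (model_weight_gt0 model _)).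
  apply: le_trans (hM _ _); rewrite ler_piMl ?lern1 ?leq_b1 //.
  by rewrite ltW // (model_weight_gt0 model).
have [Ns hNs] : exists Ns : 'I_k.+1 -> H -> H, forall i, is_shift v (up i) (Ns i).
  apply: (@fun_choice _ _ (fun i N => is_shift v (up i) N)) => i.
  have [M M0 hM] := growth i.
  by apply: (@shift_exists _ _ _ _ _ gramv (up i) (dn i) M M0 (adjU i)).
have [N hN] : exists N : 'I_k.+1 -> H -> H, forall i, is_shift v (dn i) (N i).
  apply: (@fun_choice _ _ (fun i N => is_shift v (dn i) N)) => i.
  have [M M0 hM] := growth i.
  by apply: (@shift_exists _ _ _ _ _ gramv (dn i) (up i) M M0 (adjD i)).
have Nv i x : N i (v x) = v (up i x) by apply: (shift_apply gramv _ (adjD i) (hN i)).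
have aN i : is_adjoint (N i) (Ns i) by apply: (shift_adjoint gramv (adjD i) (hN i) (hNs i)).
pose v0 n := v (n, mzero _).
have gram0 n p : '[v0 n, v0 p] = '[g n, g p].
  by rewrite gramv gram /moment_kernel /= !madd0.
have iso s : hnorm (comb v0 s) <= 1 * hnorm (comb g s).
  rewrite mul1r /hnorm !comb_gram; under eq_bigr => p _ do under eq_bigr => q _ do rewrite gram0.
  exact: lexx.
(* [bounded_transport] yields the adjoint E of the isometry g_n |-> v0 n; the embedding V is
   recovered as the adjoint of E. *)
have [E [bE Eg _]] := bounded_transport ler01 iso.
have [V EV] := adjoint_exists bE.
have bV := adjoint_bounded bE EV.
have VE x y : '[V x, y] = '[x, E y] by rewrite innerC -EV -innerC.
have EVid x : E (V x) = x.
  have EVg n : E (v0 n) = g n by apply: (total_ext tg) => p; rewrite Eg gram0.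
  by apply: (total_ext tg) => n; rewrite Eg -EV EVg.
exists H, V, N; split; first exact: (proj1 bV).
split; first by move=> x y; rewrite VE EVid.
split.
  move=> i; have [bNi _ _] := hN i; split=> //; exists (Ns i); split; first exact: aN.
  by move=> x; apply: (shift_comm _ _ (hN i) (hNs i)) => z.
split.
  move=> i j z; apply: (shift_comm _ _ (hN i) (hN j)) => y.
  by rewrite /dn /= mshiftC.
move=> i x; apply: inner_ext => y.
rewrite aN !VE (adjP (bT i)); congr ('[_, _]).
by apply: (total_ext tg) => n; rewrite -(adjP (bT i)) Tg !Eg -aN Nv.
Qed.

End HankelSubnormal.

(** * Hyponormality *)

Lemma psd_two (R : realType) (h : nat -> R) : 0 <= h 0%N -> 0 <= h 2 ->
  h 1%N ^+ 2 <= h 0%N * h 2 -> psd (fun a b : bool => h (a + b)%N).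
Proof.
move=> h0 h2 det; split=> [a b|s]; first by rewrite addnC.
pose u := \sum_(p <- s | ~~ p.2) p.1; pose w := \sum_(p <- s | p.2) p.1.
have -> : qform (fun a b : bool => h (a + b)%N) s =
    h 0%N * u ^+ 2 + 2 * h 1%N * u * w + h 2 * w ^+ 2.
  have inner (a : bool) : \sum_(q <- s) q.1 * h (a + q.2)%N = u * h a + w * h a.+1.
    rewrite (bigID (fun p : R * bool => ~~ p.2)) /= /u /w !mulr_suml; congr (_ + _).
      by apply: eq_bigr => q /negbTE ->; rewrite addn0.
    apply: eq_big => q; first by rewrite negbK.
    by rewrite negbK => ->; rewrite addn1.
  rewrite /qform; under eq_bigr => p _ do
    (under eq_bigr => q _ do rewrite -mulrA; rewrite -mulr_sumr inner).
  rewrite (bigID (fun p : R * bool => ~~ p.2)) /=.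
  rewrite (eq_bigr (fun p : R * bool => p.1 * (u * h 0%N + w * h 1%N))); last first.
    by move=> p /negbTE ->.
  rewrite -mulr_suml -/u (eq_bigl (fun p : R * bool => p.2)); last by move=> p; rewrite negbK.
  rewrite (eq_bigr (fun p : R * bool => p.1 * (u * h 1%N + w * h 2))); last by move=> p ->.
  by rewrite -mulr_suml -/w; ring.
have [E|n0] := eqVneq (h 0%N) 0.
  move: det; rewrite E mul0r => det.
  have -> : h 1%N = 0 by apply/eqP; rewrite -sqrf_eq0 eq_le det sqr_ge0.
  by rewrite mulr0 !mul0r !add0r mulr_ge0 ?sqr_ge0.
have p0 : 0 < h 0%N by rewrite lt0r n0.
(* Completing the square: h0 times the form is (h0 u + h1 w)^2 + (h0 h2 - h1^2) w^2. *)
rewrite -(pmulr_rge0 _ p0).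
have := sqr_ge0 (h 0%N * u + h 1%N * w).
have := mulr_ge0 (sqr_ge0 w) (eq_ind_r is_true det (subr_ge0 (h 1%N ^+ 2) (h 0%N * h 2))).
nra.
Qed.

Section Hyponormal.
Variables (R : realType) (k : nat) (H : hilbert R) (B : nat -> R).
Variables (g : mindex k.+1 -> H) (T : 'I_k.+1 -> H -> H).
Hypothesis model : shift_model B g T.
Local Notation c := (@model_weight R B k).

(** For positive b this says that the ratios b_(l+1) / b_l are nondecreasing, the classical
    criterion for hyponormal unilateral shifts. *)
Definition log_convex (b : nat -> R) : Prop := forall l, b l.+1 ^+ 2 <= b l * b l.+2.

Lemma hyponormal_form (x : 'I_k.+1 -> H) :
  \sum_(i < k.+1) \sum_(j < k.+1)
    '[adj (T j) (T i (x j)) - T i (adj (T j) (x j)), x i] =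
  \sum_(i < k.+1) \sum_(j < k.+1) '[T i (x j), T j (x i)] -
    '[\sum_i adj (T i) (x i), \sum_i adj (T i) (x i)].
Proof.
have [_ _ _ bT _] := model.
rewrite inner_sumr -sumrB; apply: eq_bigr => i _; rewrite inner_suml -sumrB; apply: eq_bigr => j _.
by rewrite innerBl (adj_sym (adjP (bT j))) [X in _ - X](adjP (bT i)).
Qed.

Lemma hyponormal_log_convex : jointly_hyponormal T -> log_convex B.
Proof.
have [B0 _ _ bT Tg] := model; move=> hyp l.
pose n := msingle (ord0 : 'I_k.+1) l; have nl : mabs n = l := mabs_single _ _.
(* At x_j = T_j g_n the form is <Q_T^2(I) g_n, g_n> - |Q_T(I) g_n|^2, which involves three
   consecutive values of B. *)
have := hyp (fun j => g (mshift n j)); rewrite hyponormal_form.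
under eq_bigr => i _ do under eq_bigr => j _ do rewrite !Tg mshiftC (model_norm model).
have -> : \sum_i adj (T i) (g (mshift n i)) = (B l.+1 / B l)%:C *: g n.
  under eq_bigr => i _ do rewrite (model_adj model).
  rewrite -scaler_suml -rmorph_sum -mulr_suml (model_weight_sum model) nl.
  by rewrite mulfK // gt_eqF // (model_weight_gt0 model).
have -> : \sum_(i < k.+1) \sum_(j < k.+1) (c (mshift (mshift n i) j))%:C = (B l.+2 / B l * c n)%:C.
  under eq_bigr => i _ do rewrite -rmorph_sum (model_weight_sum model) mabs_shift nl.
  rewrite -rmorph_sum -mulr_sumr (model_weight_sum model) nl !mulrA divfK //.
  by rewrite gt_eqF.
rewrite innerZl innerZr conj_RC (model_norm model) -!rmorphM -rmorphB ler0c.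
rewrite [X in _ - X]mulrA -mulrBl.
rewrite pmulr_lge0 ?(model_weight_gt0 model) // subr_ge0.
have -> : B l.+1 / B l * (B l.+1 / B l) = B l.+1 ^+ 2 / B l / B l.
  by field; rewrite gt_eqF.
rewrite ler_pM2r ?invr_gt0 //.
by rewrite ler_pdivrMr // mulrC.
Qed.

(** [None] adjoins the identity to the tuple: joint hyponormality is obtained from positivity of the
    form <T_a x_b, T_b x_a> over 1, T_1, ..., T_m, the first-order part of the condition for
    subnormality. *)
Definition act (a : option 'I_k.+1) : H -> H := if a is Some i then T i else id.
Definition shift_by (a : option 'I_k.+1) (n : mindex k.+1) : mindex k.+1 :=
  if a is Some i then mshift n i else n.
Definition unit_index (a : option 'I_k.+1) : mindex k.+1 := shift_by a (mzero _).

Lemma act_bounded a : bounded_op (act a).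
Proof. by have [_ _ _ bT _] := model; case: a => [i|]; [exact: bT | exact: bounded_id]. Qed.

Lemma act_model a n : act a (g n) = g (madd n (unit_index a)).
Proof.
have [_ _ _ _ Tg] := model; case: a => [i|]; rewrite /act /unit_index /=.
  by rewrite Tg mshift_addr madd0.
by rewrite madd0.
Qed.

(** The second multi-index is 0 or a unit vector, so the minimum of the pair has modulus 0 or 1, and
    only the 2 by 2 Hankel matrices of B, whose determinants [log_convex] controls, are involved. *)
Lemma psd_first_order : log_convex B ->
  psd (fun x y : option 'I_k.+1 * mindex k.+1 =>
    (madd x.2 (unit_index y.1) == madd y.2 (unit_index x.1))%:R * c (madd x.2 (unit_index y.1))).
Proof.
move=> lc; have [B0 _ _ _ _] := model.
apply: (@psd_model R k B _ (fun x => x.2) (fun x => unit_index x.1)) => l.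
pose f (x : option 'I_k.+1 * mindex k.+1) := (0 < mabs (mmin x.2 (unit_index x.1)))%N.
have fE x : mabs (mmin x.2 (unit_index x.1)) = f x.
  have : (mabs (mmin x.2 (unit_index x.1)) <= 1)%N.
    apply: (@leq_trans (mabs (unit_index x.1))).
      by apply: leq_sum => i _; rewrite ffunE geq_minr.
    by case: x => [[i|] n] /=; rewrite /unit_index /= ?mabs_shift mabs0.
  by rewrite /f; case: (mabs _) => [|[|]].
have := psd_pullback f (@psd_two R (fun t => B (l + t)%N) _ _ _).
rewrite addn0 addn1 addn2 => /(_ (ltW (B0 _)) (ltW (B0 _)) (lc l)).
by apply: psd_ext => x y; rewrite !fE.
Qed.

Lemma first_order_comb (s : option 'I_k.+1 -> seq (R[i] * mindex k.+1)) : log_convex B ->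
  0 <= \sum_a \sum_b '[act a (comb g (s b)), act b (comb g (s a))].
Proof.
have [_ gram _ _ _] := model.
move/psd_first_order => pK.
have := psd_complex [seq (p.1, (b, p.2)) | b <- index_enum (option 'I_k.+1), p <- s b] pK.
rewrite big_allpairs_dep exchange_big /=.
under eq_bigr => b _ do under eq_bigr => p _ do rewrite big_allpairs_dep.
congr (_ <= _); apply: eq_bigr => b _; rewrite exchange_big; apply: eq_bigr => a _.
rewrite !(linear_comb_op (proj1 (act_bounded _))) comb_gram.
apply: eq_bigr => p _; apply: eq_bigr => q _ /=.
by rewrite !act_model gram.
Qed.

Lemma sum_option (F : option 'I_k.+1 -> R[i]) :
  \sum_a F a = F None + \sum_(i < k.+1) F (Some i).
Proof.
rewrite (bigD1 None) //=; congr (_ + _).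
rewrite (reindex_omap Some id) //=; last by case.
by apply: eq_bigl => i; rewrite eqxx.
Qed.

(* With x_None = - \sum_i T_i^* x_i the first-order form becomes the hyponormality form. *)
Lemma log_convex_hyponormal : log_convex B -> jointly_hyponormal T.
Proof.
have [_ _ tg bT _] := model; move=> lc x; rewrite hyponormal_form.
set z := \sum_i adj (T i) (x i).
pose y (a : option 'I_k.+1) : H := if a is Some i then x i else - z.
have [s hs] := fun_choice (fun a => total_dense (y a) tg).
have : 0 <= \sum_a \sum_b '[act a (y b), act b (y a)].
  apply: (ccvg_ge0 (u := fun n => \sum_a \sum_b
    '[act a (comb g (s b n)), act b (comb g (s a n))])) => [|n].
    apply: ccvg_sum => a; apply: ccvg_sum => b; apply: ccvg_inner.
      exact: (hcvg_image (act_bounded a) (hs b)).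
    exact: (hcvg_image (act_bounded b) (hs a)).
  exact: (first_order_comb (fun a => s a n)).
rewrite sum_option [X in X + _]sum_option.
under [X in _ + X]eq_bigr => i _ do rewrite sum_option /=.
rewrite /= big_split /=.
have E : \sum_i '[T i (- z), x i] = - '[z, z].
  rewrite {3}/z inner_sumr -[RHS]sumrN; apply: eq_bigr => i _.
  by rewrite (adjP (bT i)) innerNl.
have E' : \sum_i '[x i, T i (- z)] = - '[z, z].
  rewrite {2}/z inner_suml -[RHS]sumrN; apply: eq_bigr => i _.
  by rewrite (adj_sym (adjP (bT i))) (linearN_op (proj1 (bT i))) innerNr.
by rewrite E E' innerNl innerNr opprK subrr add0r addrC.
Qed.

End Hyponormal.

(** * Spherical shifts as shift models *)

Section SphericalModel.
Variables (R : realType) (m : nat) (H : hilbert R) (e : mindex m -> H).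
Variables (w : 'I_m -> mindex m -> R) (T : 'I_m -> H -> H).
Hypothesis shiftT : is_weighted_shift e w T.
Hypothesis bT : bounded_tuple T.

Lemma tpow_shift n j x : tpow T (mshift n j) x = T j (tpow T n x).
Proof.
have [_ [_ [commT _]]] := shiftT.
have iterC i y l : iter l (T i) (T j y) = T j (iter l (T i) y).
  by apply: iter_commute1 => z; apply: commT.
pose F (n : mindex m) s := foldr (fun i y => iter (n i) (T i) y) x s.
have Fout s : j \notin s -> F (mshift n j) s = F n s.
  elim: s => //= i s IH; rewrite -!/(F _ _) inE negb_or => /andP[ij js].
  by rewrite IH // ffunE eq_sym (negbTE ij) addn0.
have Fin s : uniq s -> j \in s -> F (mshift n j) s = T j (F n s).
  elim: s => //= i s IH /andP[iNs us]; rewrite inE -!/(F _ _) => /predU1P[ji|js].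
    by rewrite -ji in iNs *; rewrite Fout // ffunE eqxx addn1 iterS.
  rewrite IH // iterC ffunE; have [ij|] := eqVneq i j; last by rewrite addn0.
  by rewrite ij js in iNs.
by apply: Fin; rewrite ?enum_uniq ?mem_enum.
Qed.

Lemma tpow0 x : tpow T (mzero m) x = x.
Proof. by rewrite /tpow; elim: (enum 'I_m) => //= i s ->; rewrite ffunE. Qed.

Lemma tpow_basis n : exists2 a : R, 0 < a & tpow T n (e (mzero m)) = a%:C *: e n.
Proof.
have [_ [w0 [_ Te]]] := shiftT.
move: {2}(mabs n) (erefl (mabs n)) => l; elim: l n => [|l IH] n nl.
  have -> : n = mzero m.
    apply/ffunP => i; rewrite ffunE; move/eqP: nl; rewrite sum_nat_eq0 => /forallP /(_ i) /eqP.
    exact.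
  by exists 1 => //; rewrite tpow0 scale1r.
have [|j [p np]] := mindex_pred (n := n).
  by move=> n0; rewrite n0 mabs0 in nl.
have pl : mabs p = l by apply: succn_inj; rewrite -nl np mabs_shift.
have [a a0 Ea] := IH p pl.
exists (a * w j p); first by rewrite mulr_gt0.
by rewrite np tpow_shift Ea (linearZ_op (proj1 (bT j))) Te scalerA rmorphM.
Qed.

End SphericalModel.

(** Along the vectors T^n e_0, positive multiples of the e_n, each T_j is a pure shift; the weights
    w survive only in the norms, which [spherical_seq] prescribes. *)
Lemma spherical_model (R : realType) (k : nat) (H : hilbert R) (e : mindex k.+1 -> H)
    (w : 'I_k.+1 -> mindex k.+1 -> R) (T : 'I_k.+1 -> H -> H) (b : nat -> R) :
  is_weighted_shift e w T -> bounded_tuple T -> spherical_seq e T b ->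
  exists g, shift_model (fun l => b l ^+ 2) g T.
Proof.
move=> shiftT bT [b0 normT]; have [[e1 [e2 et]] _] := shiftT.
have [gam hgam] : exists gam : mindex k.+1 -> R, forall n,
    0 < gam n /\ tpow T n (e (mzero _)) = (gam n)%:C *: e n.
  apply: (@fun_choice _ _ (fun n a => 0 < a /\ tpow T n (e (mzero _)) = a%:C *: e n)) => n.
  by have [a a0 Ea] := tpow_basis shiftT bT n; exists a.
have gam0 n : 0 < gam n := proj1 (hgam n).
have gamE n : gam n ^+ 2 = b (mabs n) ^+ 2 * (k`!%:R * dirichlet R n).
  have := normT n; rewrite (proj2 (hgam n)) hnormZ cmod_real (gtr0_norm (gam0 n)).
  rewrite {1}/hnorm e1 sqrtr1 mulr1 => ->; rewrite exprMn sqr_sqrtr.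
    by rewrite natrM -mulrA.
  by rewrite divr_ge0.
(* Scaling by a removes the factor (m - 1)! from |T^n e_0|^2 and leaves [dirichlet] itself. *)
pose a : R := (Num.sqrt k`!%:R)^-1.
have k0 : 0 < k`!%:R :> R by rewrite ltr0n fact_gt0.
have a0 : 0 < a by rewrite invr_gt0 sqrtr_gt0.
have aa : a ^+ 2 * k`!%:R = 1 by rewrite exprVn sqr_sqrtr ?ltW // mulVf ?gt_eqF.
exists (fun n => a%:C *: tpow T n (e (mzero _))); split=> //.
- by move=> l; rewrite exprn_gt0.
- move=> n p; rewrite !(proj2 (hgam _)) !scalerA -!rmorphM innerZl innerZr conj_RC.
  have [->|np] := eqVneq n p; last by rewrite e2 ?mulr0 ?mul0r //; apply/eqP.
  rewrite e1 mulr1 mul1r -rmorphM; congr (_%:C).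
  rewrite /model_weight -expr2 exprMn gamE mulrCA [a ^+ 2 * _]mulrA aa mul1r //.
- move=> y hy; apply: et => n; rewrite innerC.
  have := hy n; rewrite (proj2 (hgam n)) scalerA -rmorphM innerZl => /eqP.
  rewrite mulf_eq0 => /orP[/eqP|/eqP ->]; last exact: conjC0.
  by move/complexI/eqP; rewrite mulf_eq0 !gt_eqF.
- by move=> j n; rewrite (linearZ_op (proj1 (bT j))) (tpow_shift shiftT).
Qed.

Lemma unilateral_model (R : realType) (H : hilbert R) (f : nat -> H) (S : H -> H) (b : nat -> R) :
  (forall l, 0 < b l) -> is_uni_weighted_shift f (fun l => b l.+1 / b l) S -> bounded_op S ->
  exists g : mindex 1 -> H, shift_model (fun l => b l ^+ 2) g (tuple1 S).
Proof.
move=> b0 [[f1 [f2 ft]] Sf] bS.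
have mabs1 (n : mindex 1) : mabs n = n ord0 by rewrite /mabs big_ord1.
have inj (n p : mindex 1) : (n ord0 == p ord0) = (n == p).
  apply/eqP/eqP => [E|-> //]; apply/ffunP => i; by rewrite (ord1 i).
exists (fun n => (b (n ord0))%:C *: f (n ord0)); split=> //.
- by move=> l; rewrite exprn_gt0.
- move=> n p; rewrite innerZl innerZr conj_RC /model_weight /dirichlet mabs1 !big_ord1 add0n.
  (* In one variable the Dirichlet weight is n! / n! = 1. *)
  rewrite divff ?pnatr_eq0 -?lt0n ?fact_gt0 // mulr1 -inj.
  have [->|np] := eqVneq; last by rewrite f2 ?mulr0 ?mul0r //; apply/eqP.
  by rewrite f1 mulr1 mul1r -rmorphM expr2.
- move=> y hy; apply: ft => l; rewrite innerC.
  have := hy (msingle ord0 l); rewrite ffunE eqxx mul1n innerZl => /eqP.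
  rewrite mulf_eq0 => /orP[/eqP|/eqP ->]; last exact: conjC0.
  by move/complexI/eqP; rewrite gt_eqF.
- move=> j n; rewrite /tuple1 (linearZ_op (proj1 bS)) Sf scalerA -rmorphM ffunE (ord1 j) eqxx addn1.
  by rewrite mulrC divfK ?gt_eqF.
Qed.

Theorem theorem5p3 (R : realType) (m : nat) (hm : (0 < m)%N)
    (H : hilbert R) (e : mindex m -> H) (w : 'I_m -> mindex m -> R)
    (T : 'I_m -> H -> H) (b : nat -> R)
    (H' : hilbert R) (f : nat -> H') (Tdelta : H' -> H') :
  is_weighted_shift e w T -> bounded_tuple T -> spherical T ->
  spherical_seq e T b ->
  is_uni_weighted_shift f (fun k => b k.+1 / b k) Tdelta -> bounded_op Tdelta ->
  [/\ (jointly_subnormal T <-> subnormal Tdelta),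
      (forall q : nat, (1 <= q)%N -> (joint_q_isometry T q <-> q_isometry Tdelta q)),
      (forall q : nat, (1 <= q)%N -> (joint_q_expansion T q <-> q_expansion Tdelta q)),
      (joint_complete_hyperexpansion T <-> complete_hyperexpansion Tdelta)
    & (jointly_hyponormal T <-> hyponormal Tdelta)].
Proof.
case: m hm e w T => // k _ e w T shiftT bT _ seqb shiftS bS.
have [g mT] := spherical_model shiftT bT seqb.
have [g' mS] := unilateral_model (proj1 seqb) shiftS bS.
have iso q : joint_q_isometry T q <-> q_isometry Tdelta q.
  exact: iff_trans (model_isometry mT q) (iff_sym (model_isometry mS q)).
have expa q : joint_q_expansion T q <-> q_expansion Tdelta q.
  exact: iff_trans (model_expansion mT q) (iff_sym (model_expansion mS q)).
split=> //.
- split=> [/(subnormal_hankel mT)|/(subnormal_hankel mS)].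
    exact: (hankel_subnormal mS).
  exact: (hankel_subnormal mT).
- by split=> hyp q q1; apply/expa/hyp.
- split=> [/(hyponormal_log_convex mT)|/(hyponormal_log_convex mS)].
    exact: (log_convex_hyponormal mS).
  exact: (log_convex_hyponormal mT).
Qed.
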